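(* Let $X$ be a rearrangement invariant space on $[0,1]$. The following are equivalent: (i) The continuous embedding $G\subset X$ holds, i.e. there is $C>0$ with $\|f\|_X\le C\|f\|_{L^{M_2}}$ for all $f\in L^\infty$. (ii) For every $q>1$ there exist constants $A(X,q),B(X,q)>0$ such that $A(X,q)(\sum_k a_k^2)^{1/2}\le\|\sum_{k\ge1}a_kw_{n_k}\|_X\le B(X,q)(\sum_ka_k^2)^{1/2}$ for all $(a_k)\in\ell^2$ and every $q$-lacunary sequence $(w_{n_k})$ of Walsh functions. (iii) There exist a sequence $(n_k)_{k\ge1}$ of nonnegative integers and constants $A(X),B(X)>0$ such that $A(X)(\sum_ka_k^2)^{1/2}\le\|\sum_{k\ge1}a_kw_{n_k}\|_X\le B(X)(\sum_ka_k^2)^{1/2}$ for all $(a_k)\in\ell^2$.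
   Context: $m$ is Lebesgue measure. A Banach function space $X$ over $[0,1]$ is a linear space of measurable functions with a complete norm such that $g\in X$, $|f|\le|g|$ a.e. imply $f\in X$, $\|f\|_X\le\|g\|_X$; it is rearrangement invariant (r.i.) if equimeasurable functions have equal norms (and membership). $L^{M_2}$ is the Orlicz space with $M_2(t)=\exp(t^2)-1$ and norm $\|f\|_{L^{M_2}}=\inf\{\lambda>0:\int_0^1M_2(|f|/\lambda)dm\le1\}$; $G$ is the closure of $L^\infty$ in $L^{M_2}$. Rademacher functions $r_k(t)=\mathrm{sign}\sin(2^k\pi t)$; Walsh functions (Paley numbering) $w_0=1$, $w_k=r_1^{a_1}\cdots r_n^{a_n}$ for $k=\sum_{i=1}^na_i2^{i-1}$, $a_i\in\{0,1\}$. $(w_{n_k})$ is $q$-lacunary if $n_{k+1}/n_k\ge q>1$ for all $k$. The series $\sum a_kw_{n_k}$ is understood as its $L^2$-sum. *)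

(* Defs.v *)
From HB Require Import structures.
From mathcomp Require Import all_boot all_order all_algebra.
From mathcomp Require Import all_classical all_reals all_analysis.
Set Implicit Arguments. Unset Strict Implicit. Unset Printing Implicit Defensive.
Import Order.TTheory GRing.Theory Num.Theory numFieldNormedType.Exports.
Local Open Scope classical_set_scope.
Local Open Scope ring_scope.

Section Defs.
Variable R : realType.
Local Notation mu := (@lebesgue_measure R).
Local Notation I01 := (`[(0:R), 1]%classic).

Definition ae01 (P : R -> Prop) : Prop := {ae mu, forall x, I01 x -> P x}.

Definition equimeasurable (f g : R -> R) : Prop :=
  forall t : R, mu [set x | I01 x /\ t < `|f x|] = mu [set x | I01 x /\ t < `|g x|].

(* A rearrangement invariant Banach function space over [0,1]:
   [inX] is the set of elements, [nrmX] the norm (only meaningful on members). *)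
Record RIspace := {
  inX : (R -> R) -> Prop;
  nrmX : (R -> R) -> R;
  mem_meas : forall f, inX f -> measurable_fun I01 f;
  mem0 : inX (fun _ => 0);
  memD : forall f g, inX f -> inX g -> inX (f \+ g);
  memZ : forall (c : R) f, inX f -> inX (fun x => c * f x);
  nrm_eq0 : forall f, inX f -> (nrmX f = 0 <-> ae01 (fun x => f x = 0));
  nrmD : forall f g, inX f -> inX g -> nrmX (f \+ g) <= nrmX f + nrmX g;
  nrmZ : forall (c : R) f, inX f -> nrmX (fun x => c * f x) = `|c| * nrmX f;
  complete : forall u : nat -> R -> R, (forall n, inX (u n)) ->
    (forall e : R, 0 < e -> exists N : nat, forall m n : nat, (N <= m)%N -> (N <= n)%N ->
        nrmX (u m \- u n) < e) ->
    exists f, inX f /\ (nrmX (u n \- f)) @[n --> \oo] --> 0;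
  ideal : forall f g : R -> R, measurable_fun I01 f -> inX g ->
    ae01 (fun x => `|f x| <= `|g x|) -> inX f /\ nrmX f <= nrmX g;
  rearr_inv : forall f g : R -> R, measurable_fun I01 f -> inX g -> equimeasurable f g ->
    inX f /\ nrmX f = nrmX g
}.

Definition Linf (f : R -> R) : Prop :=
  measurable_fun I01 f /\ exists M : R, ae01 (fun x => `|f x| <= M).

Definition M2 (t : R) : R := expR (t ^+ 2) - 1.

Definition orlicz_M2_norm (f : R -> R) : R :=
  inf [set l : R | 0 < l /\
       (\int[mu]_(x in I01) (M2 (`|f x| / l))%:E <= 1)%E].

Definition rademacher (k : nat) (t : R) : R := Num.sg (sin (2 ^+ k * pi * t)).

(* Walsh functions, Paley numbering: w_n = prod_{i >= 1, a_i = 1} r_i where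
   n = sum_i a_i 2^(i-1); bit (i-1) of n is odd (n %/ 2^(i-1)). *)
Definition walsh (n : nat) (t : R) : R :=
  \prod_(i < n | odd (n %/ 2 ^ i)) rademacher i.+1 t.

Definition lacunary (q : R) (n : nat -> nat) : Prop :=
  forall k, (0 < n k)%N /\ q <= (n k.+1)%:R / (n k)%:R.

Definition in_l2 (a : nat -> R) : Prop := (\sum_(k <oo) ((a k) ^+ 2)%:E < +oo)%E.
Definition l2norm (a : nat -> R) : R := Num.sqrt (fine (\sum_(k <oo) ((a k) ^+ 2)%:E)%E).

Definition L2sum (a : nat -> R) (n : nat -> nat) (F : R -> R) : Prop :=
  measurable_fun I01 F /\
  (\int[mu]_(x in I01) (`|\sum_(k < N) a k * walsh (n k) x - F x| ^+ 2)%:E)%E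
     @[N --> \oo] --> 0%E.

Definition walsh_equiv (X : RIspace) (n : nat -> nat) (A B : R) : Prop :=
  forall a, in_l2 a -> exists F, L2sum a n F /\ inX X F /\
    A * l2norm a <= nrmX X F /\ nrmX X F <= B * l2norm a.

End Defs.

(* Main.v *)
Require Import Defs.
From HB Require Import structures.
From mathcomp Require Import all_boot all_order all_algebra.
From mathcomp Require Import all_classical all_reals all_analysis.
From mathcomp Require Import measurable_realfun ring lra zify.
Import Order.TTheory GRing.Theory Num.Theory numFieldNormedType.Exports.
Local Open Scope ring_scope.

(* Walsh functions whose indices have distinct leading binary digits are independent
   random signs, so their linear combinations are sub-Gaussian; a [q]-lacunary sequence
   splits into boundedly many such families. Hence the [L^{M_2}] norm of a lacunary sum is
   at most a constant times the [l^2] norm of its coefficients, which gives the upper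
   estimate in (ii); the lower one holds in every r.i. space, because a lower bound on the
   second and an upper bound on the fourth moment force the sum to be large on a set of
   measure bounded below (Paley-Zygmund). Conversely, any infinite set of Walsh functions
   contains a sequence with distinct leading digits; the normalized sums of [L] of them
   have Gaussian lower tails on a range growing with [L], so their distribution
   dominates that of any bounded function in the unit ball of [L^{M_2}]. *)

(** * Dyadic averages *)

Section DyadicAverages.
Variable R : realType.
Local Notation "''J_' ( N , j )" :=
  (`](j%:R / 2 ^+ N), (j.+1%:R / 2 ^+ N)[%R) (at level 0).

(* The offset [1/3] makes [pt N j] avoid all dyadic points, where Rademacher functions
   vanish. *)
Definition pt (N j : nat) : R := (j%:R + 3^-1) / 2 ^+ N.

Definition avg (N : nat) (g : R -> R) : R := (\sum_(j < 2 ^ N) g (pt N j)) / 2 ^+ N.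

Definition dyadic (N : nat) (g : R -> R) : Prop :=
  forall (j : nat) (x y : R), x \in 'J_(N, j) -> y \in 'J_(N, j) -> g x = g y.

Lemma exp2_gt0 N : 0 < 2 ^+ N :> R. Proof. exact: exprn_gt0. Qed.
#[local] Hint Resolve exp2_gt0 : core.

Lemma pt_dyadic N j : pt N j \in 'J_(N, j).
Proof.
by rewrite in_itv /= /pt !ltr_pM2r ?invr_gt0// -(natr1 j); apply/andP; split; lra.
Qed.

Lemma dyadic_itvS N j (x : R) : x \in 'J_(N.+1, j) -> x \in 'J_(N, j./2).
Proof.
rewrite !in_itv /= !ltr_pdivlMr ?ltr_pdivrMr// exprS => /andP[h1 h2].
have e := odd_double_half j; set h := j./2 in e *.
have b0 : 0 <= (odd j)%:R :> R by [].
have b1 : (odd j)%:R <= 1 :> R by case: (odd j).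
move: h1 h2; rewrite -(natr1 j) -(natr1 h) -{1 2}e natrD -muln2 natrM => h1 h2.
by apply/andP; split; lra.
Qed.

Lemma dyadicS N g : dyadic N g -> dyadic N.+1 g.
Proof. by move=> gd j x y /dyadic_itvS xj /dyadic_itvS; exact: gd xj. Qed.

Lemma dyadicW M N g : (M <= N)%N -> dyadic M g -> dyadic N g.
Proof.
by move=> /subnK<-; elim: (N - M)%N => // k ih /ih; rewrite addSn; exact: dyadicS.
Qed.

Lemma dyadic_comp N (phi : R -> R) g : dyadic N g -> dyadic N (fun x => phi (g x)).
Proof. by move=> gd j x y xj yj; rewrite (gd j x y). Qed.

Lemma dyadic_comp2 N (phi : R -> R -> R) f g : dyadic N f -> dyadic N g ->
  dyadic N (fun x => phi (f x) (g x)).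
Proof. by move=> fd gd j x y xj yj; rewrite (fd j x y)// (gd j x y). Qed.

Lemma dyadic_sum N (I : Type) (r : seq I) (P : pred I) (g : I -> R -> R) :
  (forall i, P i -> dyadic N (g i)) -> dyadic N (fun x => \sum_(i <- r | P i) g i x).
Proof. by move=> gd j x y xj yj; apply: eq_bigr => i Pi; exact: gd xj yj. Qed.

Lemma dyadic_prod N (I : Type) (r : seq I) (P : pred I) (g : I -> R -> R) :
  (forall i, P i -> dyadic N (g i)) -> dyadic N (fun x => \prod_(i <- r | P i) g i x).
Proof. by move=> gd j x y xj yj; apply: eq_bigr => i Pi; exact: gd xj yj. Qed.

Lemma avgD N f g : avg N (fun x => f x + g x) = avg N f + avg N g.
Proof. by rewrite /avg big_split mulrDl. Qed.

Lemma avgZ N c f : avg N (fun x => c * f x) = c * avg N f.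
Proof. by rewrite /avg -mulr_sumr mulrA. Qed.

Lemma avg_cst N c : avg N (fun=> c) = c.
Proof.
by rewrite /avg sumr_const card_ord -(mulr_natr c) natrX mulfK// gt_eqF.
Qed.

Lemma avg_sum N (I : Type) (r : seq I) (P : pred I) (g : I -> R -> R) :
  avg N (fun x => \sum_(i <- r | P i) g i x) = \sum_(i <- r | P i) avg N (g i).
Proof. by rewrite /avg exchange_big/= mulr_suml. Qed.

Lemma eq_avg N f g : (forall j, f (pt N j) = g (pt N j)) -> avg N f = avg N g.
Proof. by move=> fg; rewrite /avg; under eq_bigr do rewrite fg. Qed.

Lemma le_avg N f g : (forall j, (j < 2 ^ N)%N -> f (pt N j) <= g (pt N j)) ->
  avg N f <= avg N g.
Proof.
by move=> fg; rewrite ler_pM2r ?invr_gt0//; apply: ler_sum => j _; exact: fg.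
Qed.

Lemma sum_pairs n (F : nat -> R) :
  \sum_(j < n.*2) F j = \sum_(j < n) (F j.*2 + F j.*2.+1).
Proof.
elim: n => [|n ih]; first by rewrite !big_ord0.
by rewrite doubleS 2!big_ord_recr ih [RHS]big_ord_recr /= addrA.
Qed.

Lemma avg_pairs N f :
  avg N.+1 f =
   (\sum_(j < 2 ^ N) ((f (pt N.+1 j.*2) + f (pt N.+1 j.*2.+1)) / 2)) / 2 ^+ N.
Proof.
rewrite /avg expnS mul2n (sum_pairs _ (fun j => f (pt N.+1 j))).
by rewrite -mulr_suml -mulrA -invfM exprS.
Qed.

Lemma ptS_dyadic N j (b : bool) : pt N.+1 (b + j.*2) \in 'J_(N, j).
Proof.
have := dyadic_itvS N (b + j.*2) _ (pt_dyadic N.+1 (b + j.*2)).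
by rewrite half_bit_double.
Qed.

Lemma avg_dyadicS N g : dyadic N g -> avg N.+1 g = avg N g.
Proof.
move=> gd; rewrite avg_pairs /avg; congr (_ / _); apply: eq_bigr => j _.
rewrite (gd j _ (pt N j) (ptS_dyadic N j false) (pt_dyadic _ _)).
by rewrite (gd j _ (pt N j) (ptS_dyadic N j true) (pt_dyadic _ _)) mulrDl -splitr.
Qed.

Lemma avg_dyadic M N g : (M <= N)%N -> dyadic M g -> avg N g = avg M g.
Proof.
move=> /subnK<- gd; elim: (N - M)%N => // k ih.
by rewrite addSn avg_dyadicS ?ih//; apply: dyadicW gd; exact: leq_addl.
Qed.

Lemma rademacher_itv N j (x : R) : x \in 'J_(N, j) -> rademacher N x = (-1) ^+ j.
Proof.
rewrite in_itv /= /rademacher ltr_pdivrMr ?ltr_pdivlMr// => /andP[h1 h2].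
have -> : 2 ^+ N * pi * x = (x * 2 ^+ N - j%:R) * pi + pi *+ j :> R.
  by rewrite -mulr_natr; ring.
have -> : sin ((x * 2 ^+ N - j%:R) * pi + pi *+ j) =
    (-1) ^+ j * sin ((x * 2 ^+ N - j%:R) * pi) :> R.
  elim: {h1 h2 x}j (_ * pi) => [|j ih] y; first by rewrite mulr0n addr0 expr0 mul1r.
  by rewrite mulrSr addrA sinDpi ih exprS; ring.
rewrite sgrM [X in _ * X]gtr0_sg ?mulr1.
  by rewrite sgrX sgrN1.
apply: sin_gt0_pi; rewrite pmulr_lgt0 ?pi_gt0// subr_gt0 h1 /=.
by rewrite gtr_pMl ?pi_gt0// ltrBlDr addrC natr1.
Qed.

Lemma dyadic_rademacher N : dyadic N (rademacher N).
Proof. by move=> j x y /rademacher_itv-> /rademacher_itv->. Qed.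

Lemma sqr_rademacher k N j : (k <= N)%N -> rademacher k (pt N j) ^+ 2 = 1.
Proof.
move=> kN; suff [i xi] : exists i, pt N j \in 'J_(k, i).
  by rewrite (rademacher_itv _ _ _ xi) -exprM mulnC exprM sqrrN !expr1n.
have := pt_dyadic N j; move: (pt N j) => x; elim: N j kN => [|N ih] j kN xj.
  by exists j; move: kN; rewrite leqn0 => /eqP->.
move: kN; rewrite leq_eqVlt => /predU1P[->|kN]; first by exists j.
by apply: (ih j./2 kN); exact: dyadic_itvS.
Qed.

Lemma avg_rademacherS N g : dyadic N g ->
  avg N.+1 (fun x => g x * rademacher N.+1 x) = 0.
Proof.
move=> gd; rewrite avg_pairs big1 ?mul0r// => j _.
rewrite (gd j _ (pt N j) (ptS_dyadic N j false) (pt_dyadic _ _)).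
rewrite (gd j _ (pt N j) (ptS_dyadic N j true) (pt_dyadic _ _)).
rewrite !(rademacher_itv _ _ _ (pt_dyadic _ _)) exprS -signr_odd odd_double.
by rewrite expr0; ring.
Qed.

Lemma avg_rademacher M N g : (M < N)%N -> dyadic M g ->
  avg N (fun x => g x * rademacher M.+1 x) = 0.
Proof.
move=> MN gd; rewrite (avg_dyadic M.+1)//; first exact: avg_rademacherS.
apply: (dyadic_comp2 _ *%R); [exact: dyadicS|exact: dyadic_rademacher].
Qed.

End DyadicAverages.

(** * Walsh functions *)

Section Walsh.
Variable R : realType.

Lemma walshE N n (x : R) : (n < 2 ^ N)%N ->
  walsh n x = \prod_(i < N | odd (n %/ 2 ^ i)) rademacher i.+1 x.
Proof.
have H M L : (n < 2 ^ M)%N -> \prod_(i < M + L | odd (n %/ 2 ^ i)) rademacher i.+1 x =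
    \prod_(i < M | odd (n %/ 2 ^ i)) rademacher i.+1 x.
  move=> nM; elim: L => [|L ih]; first by rewrite addn0.
  rewrite addnS big_mkcond big_ord_recr -big_mkcond /= ih divn_small ?mulr1//.
  by apply: leq_trans nM _; rewrite leq_exp2l// leq_addr.
by move=> nN; rewrite /walsh -(H n N (ltn_expl n (isT : 1 < 2)%N)) (addnC n N) (H N n nN).
Qed.

Lemma dyadic_walsh N n : (n < 2 ^ N)%N -> dyadic R N (walsh n).
Proof.
move=> nN j x y xj yj; rewrite !(walshE N)//; apply: eq_bigr => i _.
by apply: (dyadicW _ i.+1 N) xj yj; [exact: ltn_ord|exact: dyadic_rademacher].
Qed.

Lemma walshD N n (x : R) : (n < 2 ^ N)%N ->
  walsh (2 ^ N + n) x = walsh n x * rademacher N.+1 x.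
Proof.
move=> nN; rewrite (walshE N.+1) ?expnS ?mul2n -?addnn ?ltn_add2l//.
rewrite big_mkcond big_ord_recr /= divnDl// divnn expn_gt0/= (divn_small nN) addn0 /=.
rewrite -big_mkcond (walshE N) //=; congr (_ * _); apply: eq_bigl => i.
rewrite divnDl ?dvdn_exp2l// 1?ltnW// oddD -expnB// 1?ltnW//.
by rewrite oddX /= subn_eq0 leqNgt ltn_ord.
Qed.

Lemma sqr_walsh N n j : (n < 2 ^ N)%N -> walsh n (pt R N j) ^+ 2 = 1.
Proof.
move=> nN; rewrite (walshE N)// -prodrXl big1// => i _.
by rewrite sqr_rademacher.
Qed.

Lemma ltn_exp2S N n : (n < 2 ^ N.+1)%N ->
  (n < 2 ^ N)%N \/ exists2 m, (m < 2 ^ N)%N & n = (2 ^ N + m)%N.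
Proof.
rewrite expnS mul2n -addnn => nN; have [nN'|Nn] := ltnP n (2 ^ N); [by left|right].
by exists (n - 2 ^ N)%N; [rewrite ltn_subLR|rewrite subnKC].
Qed.

Lemma avg_walsh_ortho N n m : (n < 2 ^ N)%N -> (m < 2 ^ N)%N ->
  avg R N (fun x => walsh n x * walsh m x) = (n == m)%:R.
Proof.
have D M a b : (a < 2 ^ M)%N -> (b < 2 ^ M)%N -> dyadic R M (fun x => walsh a x * walsh b x).
  by move=> aM bM; apply: (dyadic_comp2 _ _ *%R); exact: dyadic_walsh.
elim: N n m => [|N ih] n m.
  rewrite expn0 !ltnS !leqn0 => /eqP-> /eqP->.
  by rewrite (eq_avg _ _ _ (fun=> 1)) ?avg_cst// => j; rewrite -expr2 sqr_walsh.
move=> /ltn_exp2S[nN|[n' nN ->]] /ltn_exp2S[mN|[m' mN ->]].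
- by rewrite avg_dyadicS ?ih//; exact: D.
- rewrite (_ : (n == _) = false); last by apply/eqP; lia.
  rewrite -[RHS](avg_rademacherS _ _ _ (D _ _ _ nN mN)).
  by apply: eq_avg => j; rewrite walshD// mulrA.
- rewrite (_ : (_ == m) = false); last by apply/eqP; lia.
  rewrite -[RHS](avg_rademacherS _ _ _ (D _ _ _ nN mN)).
  by apply: eq_avg => j; rewrite walshD// mulrAC.
- rewrite eqn_add2l -ih// -[RHS]avg_dyadicS; last exact: D.
  by apply: eq_avg => j; rewrite !walshD// mulrACA -expr2 sqr_rademacher// mulr1.
Qed.

Lemma avg_walsh_prod N (P : pred nat) (n : nat -> nat) (al be : nat -> R) K :
  (forall k, (k < K)%N -> P k -> (0 < n k < 2 ^ N)%N) ->
  (forall j k, (j < k < K)%N -> P j -> P k -> (trunc_log 2 (n j) < trunc_log 2 (n k))%N) ->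
  avg R N (fun x => \prod_(k < K | P k) (al k + be k * walsh (n k) x)) =
  \prod_(k < K | P k) al k.
Proof.
elim: K => [|K ih] nN nlt.
  rewrite big_ord0 (eq_avg _ _ _ (fun=> 1)) ?avg_cst// => j.
  by rewrite big_ord0.
have {}ih : avg R N (fun x => \prod_(k < K | P k) (al k + be k * walsh (n k) x)) =
  \prod_(k < K | P k) al k.
  apply: ih => [k kK|j k /andP[jk kK]]; first by apply: nN; exact: ltnW.
  by apply: nlt; rewrite jk ltnW.
have prodS (F : nat -> R) : \prod_(k < K.+1 | P k) F k =
    (\prod_(k < K | P k) F k) * (if P K then F K else 1).
  by rewrite big_mkcond big_ord_recr -big_mkcond.
rewrite (prodS al) -ih.
pose F x k := al k + be k * walsh (n k) x.
rewrite (_ : (fun x => _) = fun x => (\prod_(k < K | P k) F x k) * (if P K then F x K else 1));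
  last by apply/funext => x; exact: (prodS (F x)).
have [PK|_] := ifPn; last by rewrite mulr1; apply: eq_avg => j; rewrite mulr1.
have /andP[nK0 nKN] := nN K (ltnSn K) PK; set b := trunc_log 2 (n K).
have bnK : (2 ^ b <= n K)%N := trunc_logP (isT : 1 < 2)%N nK0.
have nKb : (n K < 2 ^ b.+1)%N := trunc_log_ltn _ (isT : 1 < 2)%N.
have [?|[m mb nKE]] := ltn_exp2S _ _ nKb; first lia.
have bN : (b < N)%N.
  by rewrite -(ltn_exp2l (m := 2))//; exact: leq_ltn_trans nKN.
have Hd : dyadic R b (fun x => \prod_(k < K | P k) (al k + be k * walsh (n k) x)).
  apply: dyadic_prod => k Pk; apply: (dyadic_comp _ _ (fun y => al k + be k * y)).
  apply: dyadic_walsh; apply: leq_trans (trunc_log_ltn _ (isT : 1 < 2)%N) _.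
  by rewrite leq_exp2l//; apply: nlt => //; rewrite ltnSn ltn_ord.
have Wd := dyadic_walsh _ _ mb.
rewrite mulrC -avgZ -[RHS]addr0 -[X in _ + X](mulr0 (be K)).
rewrite -(avg_rademacher _ _ _ _ bN (dyadic_comp2 _ _ *%R _ _ Hd Wd)) -avgZ -avgD.
by apply: eq_avg => j; rewrite /F nKE walshD//; ring.
Qed.

End Walsh.

(** * Exponential inequalities *)

Section ExpBounds.
Variable R : realType.
Implicit Types y u : R.

Lemma coshR_le y : expR y + expR (- y) <= 2 * expR (3 * y ^+ 2).
Proof.
wlog y0 : y / 0 <= y => [wl|].
  have [/wl//|/ltW y0] := leP 0 y.
  by rewrite addrC -sqrrN -{2}(opprK y); apply: wl; rewrite oppr_ge0.
have [y3|y3] := leP y 3^-1.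
  have le1 z : `|z| <= 3^-1 -> expR z <= 1 + z + z ^+ 2 :> R.
    rewrite ler_norml => /andP[z0 z1].
    have e2 : (expR (- (z / 2))) * (1 + z + z ^+ 2) >= expR (z / 2).
      have := expR_ge1Dx (- (z / 2)); have := expR_gt0 (z / 2) => g0.
      rewrite expRN => h.
      have : expR (z / 2) <= (1 - z / 2)^-1.
        by rewrite -[expR _]invrK lef_pV2// posrE ?invr_gt0//; lra.
      set t := 1 - z / 2 => ht.
      have t0 : 0 < t by rewrite /t; lra.
      have h2 : t * (1 + z + z ^+ 2) * t >= 1.
        rewrite /t; have : 0 <= z ^+ 2 * (1 - 3 * z + z ^+ 2).
          by apply: mulr_ge0; [exact: sqr_ge0|nra].
        by move=> ?; nra.
      apply: (le_trans ht); rewrite -div1r ler_pdivrMr//.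
      apply: (le_trans h2); rewrite ler_pM2r// ler_pM2r//; nra.
    have := ler_wpM2l (ltW (expR_gt0 (z / 2))) e2.
    by rewrite mulrA -!expRD -splitr subrr expR0 mul1r.
  have := le1 y; have := le1 (- y); rewrite normrN ger0_norm// => /(_ y3) h1 /(_ y3) h2.
  have := expR_ge1Dx (3 * y ^+ 2); nra.
have h1 : expR y <= expR (3 * y ^+ 2) by rewrite ler_expR; nra.
have h2 : expR (- y) <= expR y by rewrite ler_expR; lra.
by lra.
Qed.

Lemma coshR_ge y : y ^+ 2 <= 8 -> 2 * expR (y ^+ 2 / 16) <= expR y + expR (- y).
Proof.
wlog y0 : y / 0 <= y => [wl|y8].
  have [/wl//|/ltW y0] := leP 0 y.
  by rewrite addrC -sqrrN -{4}(opprK y); apply: wl; rewrite oppr_ge0.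
have h : y / 2 <= expR (y / 2) - expR (- (y / 2)).
  rewrite expRN; have e := expR_ge1Dx (y / 2).
  have : (expR (y / 2))^-1 <= 1 by rewrite invf_le1 ?expR_gt0//; lra.
  by lra.
have h2 : (y / 2) ^+ 2 <= (expR (y / 2) - expR (- (y / 2))) ^+ 2 by nra.
have e1 : (expR (y / 2) - expR (- (y / 2))) ^+ 2 = expR y + expR (- y) - 2.
  have -> : expR y = expR (y / 2) ^+ 2 by rewrite -expRM_natl; congr expR; field.
  have -> : expR (- y) = expR (- (y / 2)) ^+ 2 by rewrite -expRM_natl; congr expR; field.
  have : expR (y / 2) * expR (- (y / 2)) = 1 by rewrite -expRD subrr expR0.
  by move=> p; rewrite sqrrB p; ring.
have z0 : 0 < 1 - y ^+ 2 / 16 by lra.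
have : expR (y ^+ 2 / 16) <= (1 - y ^+ 2 / 16)^-1.
  rewrite -[expR _]invrK lef_pV2// ?posrE ?invr_gt0 ?expR_gt0// -expRN.
  exact: expR_ge1Dx.
have : (1 - y ^+ 2 / 16)^-1 <= 1 + y ^+ 2 / 8.
  by rewrite -div1r ler_pdivrMr//; have := sqr_ge0 y; nra.
by lra.
Qed.

Lemma expR_convex24 u : 24 * (expR (u / 24) - 1) <= expR u - 1.
Proof.
have -> : expR u = expR (u / 24) * expR (23 * (u / 24)) by rewrite -expRD; congr expR; field.
set v := u / 24; have h := expR_ge1Dx (23 * v); have h2 := expR_ge1Dx (- v).
have : expR v * (1 - v) <= 1.
  rewrite -[X in _ <= X](mulfV (lt0r_neq0 (expR_gt0 v))) -expRN.
  by rewrite ler_pM2l ?expR_gt0.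
by have := ler_wpM2l (ltW (expR_gt0 v)) h; nra.
Qed.

Lemma sqr_le_expR u : 0 <= u -> u ^+ 2 <= 4 * expR u.
Proof.
move=> u0; have h := expR_ge1Dx (u / 2).
have -> : expR u = expR (u / 2) ^+ 2 by rewrite -expRM_natl; congr expR; field.
by nra.
Qed.

Lemma expR_mean_le (m : nat) (y : nat -> R) : (0 < m)%N ->
  expR ((\sum_(r < m) y r) / m%:R) <= (\sum_(r < m) expR (y r)) / m%:R.
Proof.
move=> m0; have m0' : 0 < m%:R :> R by rewrite ltr0n.
set b := _ / _; rewrite ler_pdivlMr//.
have -> : expR b * m%:R = \sum_(r < m) expR b * (1 + (y r - b)).
  rewrite -mulr_sumr big_split sumrB /= !sumr_const card_ord -[b *+ m]mulr_natr.
  by rewrite /b divfK ?gt_eqF// subrr addr0.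
apply: ler_sum => r _; have -> : expR (y r) = expR b * expR (y r - b).
  by rewrite -expRD addrCA subrr addr0.
by rewrite ler_pM2l ?expR_gt0// expR_ge1Dx.
Qed.

(* [e^(y^2) = max_t e^(t y - t^2/4)], the maximum being at [t = 2y]; here [t] is
   restricted to integers, which costs a factor [e^(1/4)]. *)
Lemma expR_sqr_le (J : nat) y : 2 * `|y| < J%:R ->
  expR (y ^+ 2) <=
  expR 4^-1 * \sum_(j < J) expR (- (j%:R ^+ 2 / 4)) * (expR (j%:R * y) + expR (j%:R * - y)).
Proof.
move=> yJ; have y0 : 0 <= 2 * `|y| by rewrite mulr_ge0.
set t := Num.truncn (2 * `|y|).
have /andP[t1 t2] : t%:R <= 2 * `|y| < t.+1%:R by apply: truncn_itv.
have tJ : (t < J)%N by rewrite -(ltr_nat R); exact: le_lt_trans t1 yJ.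
rewrite (bigD1 (Ordinal tJ))//= mulrDr -[leLHS]addr0 lerD//; last first.
  by rewrite mulr_ge0 ?expR_ge0// sumr_ge0// => j _; rewrite mulr_ge0 ?addr_ge0 ?expR_ge0.
have h : expR (t%:R * `|y|) <= expR (t%:R * y) + expR (t%:R * - y).
  by case: (ger0P y) => _; rewrite ?lerDl ?lerDr expR_ge0.
apply: (@le_trans _ _ (expR 4^-1 * (expR (- (t%:R ^+ 2 / 4)) * expR (t%:R * `|y|)))).
  rewrite -!expRD ler_expR -real_normK ?num_real//; move: t1 t2; rewrite -(natr1 t).
  by move=> ? ?; nra.
by rewrite ler_wpM2l ?expR_ge0// ler_wpM2l ?expR_ge0.
Qed.

Lemma sum_expR_sqr_le (J : nat) : \sum_(j < J) expR (- (j%:R ^+ 2 / 8)) <= 9 :> R.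
Proof.
set x := expR (- 8^-1) : R.
have x1 : x <= 8 / 9.
  rewrite /x expRN -[leRHS]invrK lef_pV2 ?posrE ?expR_gt0 ?invr_gt0 ?divr_gt0//.
  by have := expR_ge1Dx (8^-1 : R); lra.
have x0 : 0 <= x by exact: expR_ge0.
apply: (@le_trans _ _ (\sum_(j < J) x ^+ j)).
  apply: ler_sum => j _; rewrite /x -expRM_natl ler_expR.
  have : j%:R <= j%:R ^+ 2 :> R.
    by rewrite -natrX ler_nat; case: (nat_of_ord j) => // k; rewrite expnS expn1 leq_pmulr.
  by lra.
have := subrX1 x J; have := exprn_ge0 J x0.
have : 0 <= \sum_(j < J) x ^+ j by apply: sumr_ge0 => j _; exact: exprn_ge0.
by nra.
Qed.
End ExpBounds.

(** * Sub-Gaussian estimates for lacunary sums *)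

Section Subgaussian.
Variable R : realType.
Implicit Types (a : nat -> R) (n : nat -> nat) (P : pred nat).

Definition wsum a n K (x : R) : R := \sum_(k < K) a k * walsh (n k) x.

Lemma avg_expR_indep N P n a K l :
  (forall k, (k < K)%N -> P k -> (0 < n k < 2 ^ N)%N) ->
  (forall j k, (j < k < K)%N -> P j -> P k -> (trunc_log 2 (n j) < trunc_log 2 (n k))%N) ->
  avg R N (fun x => expR (l * \sum_(k < K | P k) a k * walsh (n k) x)) =
  \prod_(k < K | P k) ((expR (l * a k) + expR (- (l * a k))) / 2).
Proof.
move=> nN nlt; rewrite -(avg_walsh_prod _ _ _ _ (fun k => (expR (l * a k) + expR (- (l * a k))) / 2)
  (fun k => (expR (l * a k) - expR (- (l * a k))) / 2) _ nN nlt).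
apply: eq_avg => j; rewrite mulr_sumr expR_sum; apply: eq_bigr => k Pk.
have /andP[_ kN] := nN k (ltn_ord k) Pk.
have /eqP := sqr_walsh R N (n k) j kN; rewrite sqrf_eq1 => /orP[|] /eqP ->.
  by rewrite !mulr1; field.
by rewrite !mulrN1 mulrN; field.
Qed.

Lemma avg_expR_indep_le N P n a K l :
  (forall k, (k < K)%N -> P k -> (0 < n k < 2 ^ N)%N) ->
  (forall j k, (j < k < K)%N -> P j -> P k -> (trunc_log 2 (n j) < trunc_log 2 (n k))%N) ->
  avg R N (fun x => expR (l * \sum_(k < K | P k) a k * walsh (n k) x)) <=
  expR (3 * l ^+ 2 * \sum_(k < K | P k) (a k) ^+ 2).
Proof.
move=> nN nlt; rewrite avg_expR_indep// mulr_sumr expR_sum; apply: ler_prod => k _.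
rewrite divr_ge0 ?addr_ge0 ?expR_ge0//= ler_pdivrMr// [leRHS]mulrC.
by apply: le_trans (coshR_le _ _) _; rewrite exprMn mulrA.
Qed.

Lemma lacunary_mulr (q : R) n (m : nat) : 1 < q -> lacunary q n -> 2 <= q ^+ m ->
  forall j k, (j + m <= k)%N -> (2 * n j <= n k)%N.
Proof.
move=> q1 lac qm j k jmk.
have step i : q * (n i)%:R <= (n i.+1)%:R.
  by have [n0] := lac i; rewrite ler_pdivlMr ?ltr0n.
have pow i : q ^+ i * (n j)%:R <= (n (j + i)%N)%:R.
  elim: i => [|i ih]; first by rewrite mul1r addn0.
  rewrite addnS exprS -mulrA; apply: le_trans (step _).
  by rewrite ler_pM2l//; lra.
have -> : k = (j + (k - j))%N by rewrite subnKC//; lia.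
rewrite -(ler_nat R) natrM; apply: le_trans (pow _).
rewrite ler_wpM2r//; apply: (le_trans qm); rewrite ler_weXn2l ?ltW//; lia.
Qed.

Lemma sum_residues (V : nmodType) (m K : nat) (F : nat -> V) : (0 < m)%N ->
  \sum_(k < K) F k = \sum_(r < m) \sum_(k < K | (k %% m == r)%N) F k.
Proof.
move=> m0; rewrite (partition_big (fun k : 'I_K => Ordinal (ltn_pmod k m0)) xpredT)//=.
Qed.

(* Each residue class of indices mod [m] is a family of independent signs: there the
   indices [n k] at least double, so their leading binary digits are distinct. *)
Lemma avg_expR_lacunary (q : R) n (m : nat) N a K l : 1 < q -> lacunary q n ->
  (0 < m)%N -> 2 <= q ^+ m ->
  (forall k, (k < K)%N -> (n k < 2 ^ N)%N) ->
  avg R N (fun x => expR (l * wsum a n K x)) <=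
  expR (3 * m%:R ^+ 2 * (\sum_(k < K) (a k) ^+ 2) * l ^+ 2).
Proof.
move=> q1 lac m0 qm nN; have m0' : 0 < m%:R :> R by rewrite ltr0n.
pose S r x := \sum_(k < K | (k %% m == r)%N) a k * walsh (n k) x.
have split x : l * wsum a n K x = (\sum_(r < m) (m%:R * l) * S r x) / m%:R.
  rewrite /wsum (sum_residues _ m K (fun k => a k * walsh (n k) x) m0) -mulr_sumr; field; exact: lt0r_neq0.
apply: (@le_trans _ _ (avg R N (fun x => m%:R^-1 * \sum_(r < m) expR ((m%:R * l) * S r x)))).
  by apply: le_avg => j _; rewrite split [leRHS]mulrC (expR_mean_le _ _ (fun r => _ * S r _)).
rewrite avgZ avg_sum mulrC ler_pdivrMr//.
apply: (@le_trans _ _ (\sum_(r < m) expR (3 * m%:R ^+ 2 * (\sum_(k < K) a k ^+ 2) * l ^+ 2))).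
  apply: ler_sum => r _.
  apply: (le_trans (avg_expR_indep_le N (fun k => (k %% m == r)%N) n a K (m%:R * l) _ _)).
  - by move=> k kK _; rewrite nN// andbT; have [] := lac k.
  - move=> j k /andP[jk kK] /eqP jr /eqP kr.
    have [n0 _] := lac j.
    have jmk : (j + m <= k)%N.
      have e1 := divn_eq j m; have e2 := divn_eq k m.
      have : (j %/ m < k %/ m)%N.
        by rewrite ltnNge; apply/negP => h; have := leq_mul h (leqnn m); lia.
      by rewrite -(leq_pmul2r m0) mulSn; lia.
    apply: trunc_log_max => //; apply: leq_trans (lacunary_mulr _ _ _ q1 lac qm _ _ jmk).
    by rewrite expnS leq_pmul2l//; exact: trunc_logP.
  rewrite ler_expR (_ : 3 * _ * _ * _ = 3 * (m%:R * l) ^+ 2 * (\sum_(k < K) a k ^+ 2)); last by ring.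
  apply: ler_wpM2l; first by rewrite mulr_ge0 ?sqr_ge0.
  rewrite [leRHS](bigID (fun k : 'I_K => (k %% m == r)%N))/= lerDl.
  by apply: sumr_ge0 => k _; exact: sqr_ge0.
by rewrite sumr_const card_ord -[leLHS]mulr_natr.
Qed.

Lemma avg_expR_sqr N (S : R -> R) (D : R) : 0 < D ->
  (forall l, avg R N (fun x => expR (l * S x)) <= expR (D * l ^+ 2)) ->
  avg R N (fun x => expR (S x ^+ 2 / (192 * D))) <= 2.
Proof.
move=> D0 mgf; pose c := Num.sqrt (8 * D).
have c0 : 0 < c by rewrite sqrtr_gt0 mulr_gt0.
have c2 : c ^+ 2 = 8 * D by rewrite sqr_sqrtr// mulr_ge0// ltW.
have [J HJ] : exists J : nat, forall j, (j < 2 ^ N)%N -> 2 * `|S (pt R N j) / c| < J%:R.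
  exists (\max_(j < 2 ^ N) (Num.truncn (2 * `|S (pt R N j) / c|)).+1)%N => j jN.
  have /andP[_ h] := truncn_itv (mulr_ge0 (ler0n R 2) (normr_ge0 (S (pt R N j) / c))).
  by apply: lt_le_trans h _; rewrite ler_nat (leq_bigmax (Ordinal jN)).
have e32 : expR 4^-1 <= 4 / 3 :> R.
  rewrite -[leLHS]invrK -[leRHS]invrK lef_pV2 ?posrE ?invr_gt0 ?expR_gt0 ?divr_gt0//.
  by rewrite -expRN; have := expR_ge1Dx (- 4^-1 : R); lra.
have b24 : avg R N (fun x => expR ((S x / c) ^+ 2)) <= 24.
  apply: (@le_trans _ _ (avg R N (fun x => expR 4^-1 * \sum_(j < J)
     expR (- (j%:R ^+ 2 / 4)) * (expR ((j%:R / c) * S x) + expR (- (j%:R / c) * S x))))).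
    apply: le_avg => j jN; apply: (le_trans (expR_sqr_le _ _ _ (HJ j jN))).
    rewrite ler_pM2l ?expR_gt0// ler_sum// => i _; rewrite ler_pM2l ?expR_gt0//.
    by rewrite le_eqVlt; apply/orP; left; apply/eqP; congr (expR _ + expR _); field; exact: lt0r_neq0.
  rewrite avgZ avg_sum.
  apply: (@le_trans _ _ (expR 4^-1 * \sum_(j < J) 2 * expR (- (j%:R ^+ 2 / 8)))).
    rewrite ler_pM2l ?expR_gt0// ler_sum// => i _; rewrite avgZ avgD.
    have cE : D * (i%:R / c) ^+ 2 = i%:R ^+ 2 / 8.
      by rewrite expr_div_n c2; field; exact: lt0r_neq0.
    have := mgf (i%:R / c); have := mgf (- (i%:R / c)); rewrite sqrrN cE => h1 h2.
    apply: (@le_trans _ _ (expR (- (i%:R ^+ 2 / 4)) * (2 * expR (i%:R ^+ 2 / 8)))).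
      by rewrite ler_pM2l ?expR_gt0//; lra.
    by rewrite mulrCA -expRD ler_pM2l// ler_expR; lra.
  rewrite -mulr_sumr; have := sum_expR_sqr_le R J; have := expR_gt0 (4^-1 : R).
  set T := \sum_(_ < _) _ => ? ?; apply: (@le_trans _ _ (expR 4^-1 * 18)); last by lra.
  by rewrite ler_pM2l//; lra.
have : avg R N (fun x => 24 * (expR (S x ^+ 2 / (192 * D)) + -1)) <=
       avg R N (fun x => expR ((S x / c) ^+ 2) + -1).
  apply: le_avg => j _; rewrite (_ : _ / (192 * D) = (S (pt R N j) / c) ^+ 2 / 24).
    exact: expR_convex24.
  by rewrite expr_div_n c2; field; exact: lt0r_neq0.
by rewrite avgZ !avgD !avg_cst; lra.
Qed.

Lemma avg_exp4 N (S : R -> R) (L : R) : 0 < L ->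
  avg R N (fun x => expR (S x ^+ 2 / L)) <= 2 ->
  avg R N (fun x => S x ^+ 2 ^+ 2) <= 8 * L ^+ 2.
Proof.
move=> L0 h; apply: (@le_trans _ _ (avg R N (fun x => (L ^+ 2 * 4) * expR (S x ^+ 2 / L)))).
  apply: le_avg => j _; rewrite -mulrA mulrC -ler_pdivrMr ?exprn_gt0// -expr_div_n.
  by apply: sqr_le_expR; rewrite divr_ge0 ?sqr_ge0 ?ltW.
by rewrite avgZ; have := ler_wpM2l (mulr_ge0 (ltW (exprn_gt0 2 L0)) (ler0n R 4)) h; lra.
Qed.

Lemma paley_zygmund N (Y : R -> R) (mu V : R) : 0 < mu -> 0 < V ->
  (forall x, 0 <= Y x) -> mu <= avg R N Y -> avg R N (fun x => Y x ^+ 2) <= V ->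
  mu ^+ 2 / (4 * V) <= avg R N (fun x => (mu / 2 <= Y x)%R%:R).
Proof.
move=> mu0 V0 Y0 muY YV; set p := avg _ _ (fun x => _%:R).
pose kap := mu / (2 * V); have kap0 : 0 < kap by rewrite divr_gt0// mulr_gt0.
(* AM-GM: [Y <= mu/2 + Y 1_(Y >= mu/2)] and [Y 1 <= (kap Y^2 + 1 / kap) / 2] *)
have : avg R N Y <= avg R N (fun x => mu / 2 + ((kap / 2) * Y x ^+ 2 + (2 * kap)^-1 * (mu / 2 <= Y x)%R%:R)).
  apply: le_avg => j _; have := Y0 (pt R N j); set y := Y _ => y0.
  have [muy|ymu] := leP (mu / 2) y; rewrite ?mulr1 ?mulr0.
    have : 0 <= (kap * y - 1) ^+ 2 by exact: sqr_ge0.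
    have -> : (2 * kap)^-1 = kap^-1 / 2 by field; exact: lt0r_neq0.
    move=> h; rewrite -(ler_pM2l kap0).
    have -> : kap * (mu / 2 + (kap / 2 * y ^+ 2 + kap^-1 / 2)) =
        kap * mu / 2 + (kap * y) ^+ 2 / 2 + 1 / 2 by field; exact: lt0r_neq0.
    have : 0 <= kap * mu by rewrite mulr_ge0 ?ltW.
    by nra.
  have : 0 <= kap / 2 * y ^+ 2 by apply: mulr_ge0; [lra|exact: sqr_ge0].
  by lra.
rewrite !avgD avg_cst !avgZ -/p => h.
have : mu <= mu / 2 + (kap / 2 * V + (2 * kap)^-1 * p).
  have : kap / 2 * avg R N (fun x => Y x ^+ 2) <= kap / 2 * V.
    by rewrite ler_pM2l// divr_gt0.
  by lra.
have -> : kap / 2 * V = mu / 4 by rewrite /kap; field; exact: lt0r_neq0.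
have -> : (2 * kap)^-1 = V / mu by rewrite /kap; field; rewrite !lt0r_neq0.
move=> {}h; rewrite ler_pdivrMr ?mulr_gt0//.
have : mu / 4 <= V * p / mu by rewrite mulrAC; lra.
by rewrite ler_pdivlMr// expr2; lra.
Qed.

Lemma avg_wsum_sqr N n a K : injective n -> (forall k, (k < K)%N -> (n k < 2 ^ N)%N) ->
  avg R N (fun x => wsum a n K x ^+ 2) = \sum_(k < K) a k ^+ 2.
Proof.
move=> ninj nN.
rewrite (_ : (fun x => _) = fun x => \sum_(i < K) \sum_(j < K) (a i * a j) * (walsh (n i) x * walsh (n j) x)).
  rewrite avg_sum; apply: eq_bigr => i _; rewrite avg_sum (bigD1 i)//= big1 ?addr0.
    by rewrite avgZ avg_walsh_ortho ?nN// eqxx mulr1 expr2.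
  move=> j ji; rewrite avgZ avg_walsh_ortho ?nN// (inj_eq ninj).
  by rewrite val_eqE eq_sym (negPf ji) mulr0.
apply/funext => x; rewrite expr2 /wsum mulr_suml; apply: eq_bigr => i _.
by rewrite mulr_sumr; apply: eq_bigr => j _; rewrite mulrACA.
Qed.

End Subgaussian.

(** * Integrals of dyadic step functions *)

Section DyadicIntegral.
Variable R : realType.
Local Notation mu := (@lebesgue_measure R).
Local Notation I01 := (`[(0:R), 1]%classic).
Local Open Scope classical_set_scope.

Lemma measurable_sg : measurable_fun setT (Num.sg : R -> R).
Proof.
rewrite (_ : Num.sg = \1_(`]0, +oo[%classic : set R) \- \1_(`]-oo, 0[%classic : set R)).
  by apply: measurable_funB; exact: measurable_indic.
apply/funext => x; rewrite /= !indicE !mem_setE /= !in_itv /= andbT.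
have [x0|x0|->] := ltrgt0P x; first by rewrite gtr0_sg// subr0.
  by rewrite ltr0_sg// sub0r.
by rewrite sgr0 subr0.
Qed.

Lemma measurable_walsh n : measurable_fun setT (walsh n : R -> R).
Proof.
rewrite /walsh; under eq_fun do rewrite big_mkcond.
apply: measurable_prod => i _; case: (odd (n %/ 2 ^ i)); last exact: measurable_cst.
apply: (measurableT_comp measurable_sg).
apply: continuous_measurable_fun => x; apply: (continuous_comp (f := *%R (2 ^+ i.+1 * pi)) (g := sin)); last exact: continuous_sin.
exact: mulrl_continuous.
Qed.

Lemma measurable_wsum (a : nat -> R) n K : measurable_fun setT (wsum R a n K).
Proof.
apply: measurable_sum => k; apply: measurable_funM; first exact: measurable_cst.
exact: measurable_walsh.
Qed.

Lemma dyadic_wsum N (a : nat -> R) n K : (forall k, (k < K)%N -> (n k < 2 ^ N)%N) ->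
  dyadic R N (wsum R a n K).
Proof.
move=> nN; apply: dyadic_sum => k _; apply: (dyadic_comp _ _ (fun y => a k * y)).
by apply: dyadic_walsh; exact: nN.
Qed.

Lemma integral_dyadic N (g : R -> R) : dyadic R N g -> measurable_fun setT g ->
  (forall x, 0 <= g x) -> (\int[mu]_(x in I01) (g x)%:E)%E = (avg R N g)%:E.
Proof.
move=> gd gm g0.
have mE (D : set R) : measurable_fun D (fun x => (g x)%:E).
  by apply/measurable_EFinP; exact: measurable_funTS.
have H m : (\int[mu]_(x in `](0%R:R), (m%:R / 2 ^+ N)%R]%classic) (g x)%:E)%E =
    ((\sum_(j < m) g (pt R N j)) / 2 ^+ N)%:E.
  elim: m => [|m ih].
    by rewrite mul0r set_itvoc0 integral_set0 big_ord0 mul0r.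
  have le0 : 0 <= m%:R / 2 ^+ N :> R by rewrite divr_ge0// exprn_ge0.
  have le1 : m%:R / 2 ^+ N < m.+1%:R / 2 ^+ N :> R.
    by rewrite ltr_pM2r ?invr_gt0 ?exprn_gt0// ltr_nat.
  rewrite (itv_bndbnd_setU (x := BRight (m%:R / 2 ^+ N)))//; last by rewrite bnd_simp ltW.
  rewrite ge0_integral_setU//=; last 3 first.
  - exact: mE.
  - by move=> x _; rewrite lee_fin.
  - by apply/disj_setPS => x [] /=; rewrite !in_itv /= => /andP[_ h] /andP[]; rewrite ltNge h.
  rewrite ih big_ord_recr mulrDl EFinD; congr (_ + _)%E.
  rewrite integral_itv_bndoo//.
  under eq_integral => x xi.
    rewrite (gd m x (pt R N m) _ (pt_dyadic R N m)); last by move: xi; rewrite inE.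
    over.
  rewrite integral_cst//= lebesgue_measure_itv /= lte_fin le1 -EFinD -EFinM; congr (_%:E).
  rewrite -mulrBl -(natr1 m) (addrC _ 1) addrK; ring.
rewrite -integral_itv_obnd_cbnd//; have := H (2 ^ N)%N.
by rewrite natrX divff// ?lt0r_neq0 ?exprn_gt0.
Qed.

Lemma measure_dyadic N (S : R -> R) (P : pred R) : dyadic R N S ->
  measurable_fun setT S -> measurable [set y | P y] ->
  mu [set x | I01 x /\ P (S x)] = (avg R N (fun x => (P (S x))%:R))%:E.
Proof.
move=> Sd Sm Pm.
have mA : measurable [set x | P (S x)].
  by rewrite -[X in measurable X]setTI; exact: (Sm measurableT [set y | P y]).
have eP x : (P (S x))%:R = \1_[set x | P (S x)] x :> R by rewrite indicE mem_setE.
rewrite -integral_dyadic; last 3 first.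
- exact: (dyadic_comp _ _ (fun y => (P y)%:R)).
- rewrite (_ : (fun x => _) = \1_[set x | P (S x)]); last exact/funext.
  exact: measurable_indic.
- by [].
under eq_integral do rewrite eP.
rewrite integral_indic//; congr (mu _); apply/seteqP; split => x /=; by case.
Qed.

End DyadicIntegral.

(** * Rearrangements *)

Section Rearrangement.
Variable R : realType.
Local Notation mu := (@lebesgue_measure R).
Local Notation I01 := (`[(0:R), 1]%classic).
Local Open Scope classical_set_scope.
Implicit Types f g h : R -> R.

Lemma ae01_all (P : R -> Prop) : (forall x, I01 x -> P x) -> ae01 P.
Proof. by move=> h; apply/aeW. Qed.

Definition dist h (t : R) : \bar R := mu [set x | I01 x /\ t < `|h x|].

Lemma measurable_level h (t : R) : measurable_fun I01 h ->
  measurable [set x | I01 x /\ t < `|h x|].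
Proof.
move=> mh; have := measurableT_comp (@normr_measurable R setT) mh.
move=> /(_ (measurable_itv _) `]t, +oo[%classic (measurable_itv _)).
congr measurable; apply/seteqP; split=> x /=; rewrite !in_itv /= andbT; by case.
Qed.

Lemma dist_le1 h t : measurable_fun I01 h -> (dist h t <= 1)%E.
Proof.
move=> mh; have -> : 1%E = mu I01 by rewrite lebesgue_measure_itv /= lte_fin ltr01 sube0.
by apply: le_measure; rewrite ?inE; [exact: measurable_level|exact: measurable_itv|move=> x []].
Qed.

Lemma dist_nincr h s t : measurable_fun I01 h -> s <= t -> (dist h t <= dist h s)%E.
Proof.
move=> mh st; apply: le_measure; rewrite ?inE; [exact: measurable_level..|].
by move=> x /= [xi tx]; split=> //; exact: le_lt_trans tx.
Qed.

Lemma dist_right h t (y : \bar R) : measurable_fun I01 h -> (y < dist h t)%E ->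
  exists2 s, t < s & (y < dist h s)%E.
Proof.
move=> mh yt; apply: contrapT => H.
have Hn n : (dist h (t + n.+1%:R^-1) <= y)%E.
  rewrite leNgt; apply/negP => yn; apply: H; exists (t + n.+1%:R^-1) => //.
  by rewrite ltrDl invr_gt0.
pose F n := [set x | I01 x /\ t + n.+1%:R^-1 < `|h x|].
have UF : \bigcup_n F n = [set x | I01 x /\ t < `|h x|].
  apply/seteqP; split=> x /=.
    by move=> [n _] /= [xi tn]; split=> //; apply: le_lt_trans tn; rewrite lerDl invr_ge0.
  move=> [xi tx].
  have [n nh] := ltr_add_invr tx; exists n => //; split=> //.
have : (mu (\bigcup_n F n) <= y)%E.
  have := @nondecreasing_cvg_mu _ _ _ mu F; rewrite UF.
  move=> /(_ (fun n => measurable_level _ _ mh) (measurable_level _ _ mh)).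
  have nd : {homo F : n m / (n <= m)%N >-> (n <= m)%O}.
    move=> n m nm; apply/subsetPset => x [xi tn]; split=> //; apply: le_lt_trans tn.
    by rewrite lerD2l lef_pV2 ?posrE// ler_nat ltnS.
  move=> /(_ nd) cv; rewrite -(cvg_lim (@ereal_hausdorff _) cv).
  apply: lime_le; first by apply/cvg_ex; eexists; exact: cv.
  by apply: nearW => n; exact: Hn.
by rewrite UF leNgt => /negP; apply.
Qed.

(* The cut-off [Num.max x 0] makes [rearr h] nonincreasing on the whole line: without it
   the set is unbounded for [x < 0], and the supremum then has the junk value [0]. *)
Definition rearr h (x : R) : R :=
  sup [set t | 0 <= t /\ ((Num.max x 0)%:E < dist h t)%E].

Lemma rearr_ge0 h x : 0 <= rearr h x.
Proof.
rewrite /rearr; set A := [set t | _]; have [[[t At] uA]|/sup_out->//] := pselect (has_sup A).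
by apply: le_trans (ub_le_sup uA At); case: At.
Qed.

Lemma rearr_gtP h t x : Linf h -> 0 <= t ->
  (t < rearr h x) <-> ((Num.max x 0)%:E < dist h t)%E.
Proof.
move=> [mh [M hM]] t0; have dM : dist h M = 0.
  apply: measure_negligible; first exact: measurable_level.
  by apply: negligibleS hM => y /= [yi My] H; have := H yi; rewrite leNgt My.
split=> [tr|xt].
  have [s [s0 xs] ts] : exists2 s, [set t | 0 <= t /\ ((Num.max x 0)%:E < dist h t)%E] s & t < s.
    apply: (sup_gt _ tr); apply/set0P/eqP => e; move: tr; rewrite /rearr e sup0.
    by rewrite ltNge t0.
  by apply: lt_le_trans xs _; apply: dist_nincr => //; exact: ltW.
have [s ts xs] := dist_right _ _ _ mh xt.
apply: (lt_le_trans ts); apply: ub_le_sup.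
  exists M => r [_ xr]; rewrite leNgt; apply/negP => Mr.
  have := dist_nincr _ _ _ mh (ltW Mr); rewrite dM leNgt.
  by rewrite (le_lt_trans _ xr)// lee_fin le_max lexx orbT.
by split=> //; exact: le_trans (ltW ts).
Qed.

Lemma rearr_nincr h : Linf h -> {homo rearr h : x y /~ y <= x}.
Proof.
move=> hL x y yx; rewrite leNgt; apply/negP => r.
have /(rearr_gtP _ _ _ hL (rearr_ge0 h x)) H := r.
suff : rearr h x < rearr h x by rewrite ltxx.
apply/(rearr_gtP _ _ _ hL (rearr_ge0 h x)); apply: le_lt_trans H.
by rewrite lee_fin ge_max !le_max yx lexx orbT.
Qed.

Lemma measurable_rearr h : Linf h -> measurable_fun I01 (rearr h).
Proof.
by move=> hL; apply: nonincreasing_measurable; [exact: measurable_itv|exact: rearr_nincr].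
Qed.

Lemma equimeasurable_rearr h : Linf h -> equimeasurable (rearr h) h.
Proof.
move=> hL t; have mh := hL.1.
have [t0|t0] := leP 0 t; last first.
  congr (mu _); apply/seteqP; split=> x [xi _]; split=> //; exact: lt_le_trans t0 _.
rewrite -/(dist h t); have d1 := dist_le1 h t mh.
have d0 : (0 <= dist h t)%E by exact: measure_ge0.
have dfin : dist h t \is a fin_num by rewrite ge0_fin_numE//; apply: le_lt_trans d1 _; rewrite ltry.
have -> : [set x | I01 x /\ t < `|rearr h x|] = `[0, fine (dist h t)[%classic.
  apply/seteqP; split=> x /=; rewrite !in_itv /= ger0_norm ?rearr_ge0//.
    move=> [/andP[x0 _]] /(rearr_gtP _ _ _ hL t0).
    by rewrite (max_idPl x0) x0 -(fineK dfin) lte_fin.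
  move=> /andP[x0 xd]; have x1 : x <= 1.
    by apply: (le_trans (ltW xd)); rewrite -lee_fin fineK.
  rewrite x0 x1; split=> //; apply/(rearr_gtP _ _ _ hL t0).
  by rewrite (max_idPl x0) -(fineK dfin) lte_fin.
rewrite lebesgue_measure_itv /= lte_fin; case: ltP => [_|le0].
  by rewrite sube0 fineK.
by apply/eqP; rewrite eq_le d0 /= -(fineK dfin) lee_fin.
Qed.

Lemma equimeasurable_sym f g : equimeasurable f g -> equimeasurable g f.
Proof. by move=> fg t; rewrite fg. Qed.

Variable X : RIspace R.

Lemma nrm_ge0 f : inX X f -> 0 <= nrmX X f.
Proof.
move=> fX; have fX' := memZ (-1) fX.
have : nrmX X (f \+ (fun x => -1 * f x)) = 0.
  by apply/(nrm_eq0 (memD fX fX')); apply: ae01_all => x _ /=; rewrite mulN1r subrr.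
have := nrmD fX fX'; rewrite nrmZ// normrN1 mul1r => h1 h2; rewrite h2 in h1.
by lra.
Qed.

Lemma nrm_dominated g h : Linf g -> Linf h -> inX X h ->
  (forall t, 0 <= t -> (dist g t <= dist h t)%E) -> inX X g /\ nrmX X g <= nrmX X h.
Proof.
move=> gL hL hX dgh.
have [rhX rhE] := rearr_inv (measurable_rearr _ hL) hX (equimeasurable_rearr _ hL).
have [rgX rgE] : inX X (rearr g) /\ nrmX X (rearr g) <= nrmX X (rearr h).
  apply: ideal => //; first exact: measurable_rearr.
  apply: ae01_all => x _; rewrite !ger0_norm ?rearr_ge0// leNgt; apply/negP => r.
  have /(rearr_gtP _ _ _ gL (rearr_ge0 h x)) H := r.
  suff : rearr h x < rearr h x by rewrite ltxx.
  apply/(rearr_gtP _ _ _ hL (rearr_ge0 h x)); apply: (lt_le_trans H).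
  by apply: dgh; exact: rearr_ge0.
have [gX gE] := rearr_inv gL.1 rgX (equimeasurable_sym _ _ (equimeasurable_rearr _ gL)).
by split=> //; rewrite gE -rhE.
Qed.

Definition chi (d : R) : R -> R := \1_`[0, d]%classic.

Lemma chi_gt0 d : 0 < d <= 1 -> inX X (chi d) -> 0 < nrmX X (chi d).
Proof.
move=> /andP[d0 d1] cX; rewrite lt_neqAle nrm_ge0// andbT eq_sym; apply/eqP.
move=> /(nrm_eq0 cX) [A [mA A0 sub]].
have : mu `[0, d]%classic = 0.
  apply: measure_negligible; first exact: measurable_itv.
  exists A; split=> // x xd; apply: sub => /= H.
  have : I01 x by move: xd; rewrite /= !in_itv /= => /andP[-> h]; exact: le_trans h d1.
  move=> /H; rewrite /chi indicE mem_setE; move: xd => /= -> /eqP.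
  by rewrite oner_eq0.
by rewrite lebesgue_measure_itv /= lte_fin d0 sube0 => /eqP; rewrite eqe gt_eqF.
Qed.

Lemma nrm_ge_chi g (e d : R) : inX X g -> 0 < e -> 0 < d <= 1 ->
  (d%:E <= mu [set x | I01 x /\ (e <= `|g x|)%R])%E ->
  inX X (chi d) /\ e * nrmX X (chi d) <= nrmX X g.
Proof.
move=> gX e0 /andP[d0 d1] dg; have mg := mem_meas gX.
pose A := [set x | I01 x /\ e <= `|g x|].
have mA : measurable A.
  have := measurableT_comp (@normr_measurable R setT) mg.
  move=> /(_ (measurable_itv _) `[e, +oo[%classic (measurable_itv _)).
  congr measurable; apply/seteqP; split=> x /=; rewrite !in_itv /= andbT; by case.
pose h x := e * \1_A x.
have hm : measurable_fun I01 h.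
  by apply: measurable_funM; [exact: measurable_cst|exact: measurable_indic].
have hL : Linf h.
  split=> //; exists e; apply: ae01_all => x _; rewrite /h indicE.
  by case: (x \in A); rewrite ?mulr1 ?mulr0 ?normr0 ?gtr0_norm// ltW.
have [hX hg] : inX X h /\ nrmX X h <= nrmX X g.
  apply: ideal => //; apply: ae01_all => x _; rewrite /h indicE.
  case: (boolP (x \in A)) => [|_]; last by rewrite mulr0 normr0.
  by rewrite inE => -[_ eg]; rewrite mulr1 gtr0_norm.
have cL : Linf (fun x => e * chi d x).
  split; first by apply: measurable_funM; [exact: measurable_cst|exact: measurable_indic].
  exists e; apply: ae01_all => x _; rewrite /chi indicE.
  by case: (x \in _); rewrite ?mulr1 ?mulr0 ?normr0 ?gtr0_norm// ltW.
have [cX ch] : inX X (fun x => e * chi d x) /\ nrmX X (fun x => e * chi d x) <= nrmX X h.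
  apply: nrm_dominated => // t t0; have [te|et] := ltP t e.
    apply: (@le_trans _ _ d%:E).
      have -> : d%:E = mu `[0, d]%classic by rewrite lebesgue_measure_itv /= lte_fin d0 sube0.
      apply: le_measure; rewrite ?inE; [exact: (measurable_level _ _ cL.1)|exact: measurable_itv|].
      move=> x /= [_]; rewrite /chi indicE mem_setE; case: (_ \in _) => //.
      by rewrite mulr0 normr0 ltNge t0.
    apply: (le_trans dg); apply: le_measure; rewrite ?inE; [exact: mA|exact: measurable_level|].
    move=> x Ax; split; first by case: Ax.
    by rewrite /h indicE mem_set// mulr1 gtr0_norm.
  rewrite (_ : dist _ t = 0) ?measure_ge0// /dist -[RHS](measure0 mu); congr (mu _).
  apply/seteqP; split=> x //= [_]; rewrite /chi indicE.
  by case: (x \in _); rewrite ?mulr1 ?mulr0 ?normr0 ?gtr0_norm// ltNge ?et ?t0.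
have ccX : inX X (chi d).
  have := memZ e^-1 cX; congr (inX X _); apply/funext => x.
  by rewrite mulrA mulVf ?mul1r// gt_eqF.
by split=> //; rewrite -(gtr0_norm e0) -nrmZ//; exact: le_trans hg.
Qed.

End Rearrangement.

(** * Finite lacunary sums in a rearrangement invariant space *)

Section LacunarySums.
Variable R : realType.
Local Notation mu := (@lebesgue_measure R).
Local Notation I01 := (`[(0:R), 1]%classic).
Local Open Scope classical_set_scope.
Implicit Types (a : nat -> R) (n : nat -> nat).

Lemma ex_exp2_bound n K : exists N, forall k, (k < K)%N -> (n k < 2 ^ N)%N.
Proof.
exists (\max_(k < K) n k)%N => k kK; apply: leq_ltn_trans (ltn_expl _ (isT : 1 < 2)%N).
exact: (leq_bigmax (Ordinal kK)).
Qed.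

Lemma walsh_le1 (m : nat) (x : R) : `|walsh m x| <= 1.
Proof.
rewrite /walsh normr_prod; apply: prodr_ile1 => i _; rewrite normr_ge0 /= normr_sg.
by case: (_ != 0).
Qed.

Lemma Linf_wsum a n K : Linf (wsum R a n K).
Proof.
split; first exact: measurable_funTS (measurable_wsum _ _ _ _).
exists (\sum_(k < K) `|a k|); apply: ae01_all => x _.
apply: (le_trans (ler_norm_sum _ _ _)); apply: ler_sum => k _.
by rewrite normrM ler_piMr// walsh_le1.
Qed.

Lemma M2_ge0 (t : R) : 0 <= M2 t.
Proof. by rewrite subr_ge0 -expR0 ler_expR sqr_ge0. Qed.

Lemma lacunary_inj (q : R) n : 1 < q -> lacunary q n -> injective n.
Proof.
move=> q1 lac.
have inc : {homo n : i j / (i < j)%N}.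
  apply: homo_ltn => [y x z|i]; first exact: ltn_trans.
  have [n0] := lac i; rewrite ler_pdivlMr ?ltr0n// => h; rewrite -(ltr_nat R).
  by apply: lt_le_trans h; rewrite ltr_pMl// ltr0n.
by move=> i j e; case: (ltngtP i j) => // /inc; rewrite e ltnn.
Qed.

Lemma lacunary_avg_expR_sqr (q : R) n (m : nat) N a K (T : R) : 1 < q -> lacunary q n ->
  (0 < m)%N -> 2 <= q ^+ m -> (forall k, (k < K)%N -> (n k < 2 ^ N)%N) ->
  0 < T -> \sum_(k < K) a k ^+ 2 <= T ->
  avg R N (fun x => expR (wsum R a n K x ^+ 2 / (192 * (3 * m%:R ^+ 2 * T)))) <= 2.
Proof.
move=> q1 lac m0 qm nN T0 aT; apply: avg_expR_sqr.
  by rewrite !mulr_gt0 ?exprn_gt0 ?ltr0n//.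
move=> l; apply: (le_trans (avg_expR_lacunary _ _ _ _ _ _ _ l q1 lac m0 qm nN)).
rewrite ler_expR; apply: ler_wpM2r; first exact: sqr_ge0.
by apply: ler_wpM2l aT; rewrite mulr_ge0 ?sqr_ge0.
Qed.

Lemma orlicz_wsum_le (q : R) n (m : nat) a K (s : R) : 1 < q -> lacunary q n ->
  (0 < m)%N -> 2 <= q ^+ m -> 0 < s -> \sum_(k < K) a k ^+ 2 <= s ^+ 2 ->
  orlicz_M2_norm (wsum R a n K) <= 24 * m%:R * s.
Proof.
move=> q1 lac m0 qm s0 aT; have [N nN] := ex_exp2_bound n K.
have l0 : 0 < 24 * m%:R * s by rewrite !mulr_gt0// ltr0n.
apply: ge_inf; first by exists 0 => l /= [/ltW].
split=> //.
pose phi (y : R) := M2 (`|y| / (24 * m%:R * s)).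
have phiE y : phi y = expR (y ^+ 2 / (192 * (3 * m%:R ^+ 2 * s ^+ 2))) - 1.
  rewrite /phi /M2 expr_div_n real_normK ?num_real//; congr (expR (_ / _) - 1); ring.
rewrite (integral_dyadic R N (fun x => phi (wsum R a n K x))).
- rewrite lee_fin.
  rewrite (_ : (fun x => phi _) = fun x =>
    expR (wsum R a n K x ^+ 2 / (192 * (3 * m%:R ^+ 2 * s ^+ 2))) + -1); last first.
    by apply/funext => x; rewrite phiE.
  have := lacunary_avg_expR_sqr _ _ _ _ _ _ _ q1 lac m0 qm nN (exprn_gt0 2 s0) aT.
  by rewrite avgD avg_cst; lra.
- by apply: (dyadic_comp _ _ phi); exact: dyadic_wsum.
- apply: (measurableT_comp (f := phi)); last exact: measurable_wsum.
  rewrite (_ : phi = (fun y => expR (y ^+ 2 / (192 * (3 * m%:R ^+ 2 * s ^+ 2))) - 1)); last exact/funext.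
  apply: measurable_funB; last exact: measurable_cst.
  apply: (measurableT_comp (@measurable_expR R)); apply: measurable_funM; last exact: measurable_cst.
  exact: exprn_measurable.
- by move=> x; exact: M2_ge0.
Qed.

Lemma lacunary_tail_ge (q : R) n (m : nat) a K : 1 < q -> lacunary q n ->
  (0 < m)%N -> 2 <= q ^+ m ->
  let T := \sum_(k < K) a k ^+ 2 in 0 < T ->
  (((32 * 576 ^+ 2 * m%:R ^+ 4)^-1)%:E <=
    mu [set x | I01 x /\ (Num.sqrt T / 2 <= `|wsum R a n K x|)%R])%E.
Proof.
move=> q1 lac m0 qm T T0; have [N nN] := ex_exp2_bound n K.
have m0' : 0 < m%:R :> R by rewrite ltr0n.
set L := 192 * (3 * m%:R ^+ 2 * T).
have L0 : 0 < L by rewrite !mulr_gt0 ?exprn_gt0//.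
have h4 := avg_exp4 _ _ _ _ L0 (lacunary_avg_expR_sqr _ _ _ _ _ _ _ q1 lac m0 qm nN T0 (lexx T)).
have V0 : 0 < 8 * L ^+ 2 by rewrite mulr_gt0 ?exprn_gt0//.
have := paley_zygmund _ N (fun x => wsum R a n K x ^+ 2) _ _ T0 V0 (fun x => sqr_ge0 _).
rewrite (avg_wsum_sqr _ _ _ _ _ (lacunary_inj _ _ q1 lac) nN) => /(_ (lexx _) h4).
have -> : T ^+ 2 / (4 * (8 * L ^+ 2)) = (32 * 576 ^+ 2 * m%:R ^+ 4)^-1.
  by rewrite /L; field; rewrite !lt0r_neq0.
have mS := measurable_wsum R a n K.
have mP : measurable [set y : R | T / 2 <= y ^+ 2].
  have := @exprn_measurable R setT 2 measurableT `[T / 2, +oo[%classic (measurable_itv _).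
  by rewrite setTI; congr measurable; apply/seteqP; split=> x /=; rewrite in_itv /= andbT.
rewrite -lee_fin -(measure_dyadic _ _ (wsum R a n K) (fun y => T / 2 <= y ^+ 2))//; last exact: dyadic_wsum.
move=> /le_trans; apply; apply: le_measure; rewrite ?inE.
- rewrite (_ : [set x | _] = I01 `&` (wsum R a n K @^-1` [set y : R | T / 2 <= y ^+ 2])).
    apply: measurableI; first exact: measurable_itv.
    by rewrite -[X in measurable X]setTI; exact: mS.
  by apply/seteqP; split=> x.
- rewrite (_ : [set x | _] = I01 `&` ((fun x => `|wsum R a n K x|) @^-1` `[Num.sqrt T / 2, +oo[%classic)).
    apply: measurableI; first exact: measurable_itv.
    rewrite -[X in measurable X]setTI.
    by apply: (measurableT_comp (@normr_measurable R setT) mS).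
  by apply/seteqP; split=> x /=; rewrite !in_itv /= andbT.
- move=> x /= [xi Tx]; split=> //.
  rewrite -(@ler_pXn2r _ 2) ?nnegrE ?divr_ge0 ?sqrtr_ge0//.
  rewrite real_normK ?num_real// expr_div_n (sqr_sqrtr (ltW T0)).
  by apply: le_trans Tx; lra.
Qed.

Variable X : RIspace R.

Lemma lacunary_finite_sums (C q : R) : 0 < C -> 1 < q ->
  (forall f, Linf f -> inX X f /\ nrmX X f <= C * orlicz_M2_norm f) ->
  exists A B : R, [/\ 0 < A, 0 < B & forall n, lacunary q n -> forall a K,
    let S := wsum R a n K in let s := Num.sqrt (\sum_(k < K) a k ^+ 2) in
    [/\ inX X S, A * s <= nrmX X S & nrmX X S <= B * s]].
Proof.
move=> C0 q1 emb.
have [m [m0 qm]] : exists m : nat, (0 < m)%N /\ 2 <= q ^+ m.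
  have q10 : 0 < q - 1 by rewrite subr_gt0.
  pose m := (Num.truncn (q - 1)^-1).+1; exists m; split=> //.
  have /andP[_ h] := truncn_itv (ltW (ltac:(by rewrite invr_gt0) : 0 < (q - 1)^-1)).
  have : 1 <= m%:R * (q - 1) by rewrite -ler_pdivrMr// div1r ltW.
  have bern k : 1 + k%:R * (q - 1) <= q ^+ k.
    elim: k => [|k ih]; first by rewrite mul0r addr0.
    rewrite exprS -(natr1 k); have : 0 <= k%:R * (q - 1) ^+ 2 by rewrite mulr_ge0 ?sqr_ge0.
    by move=> k0; have := ler_wpM2l (ltW (lt_trans ltr01 q1)) ih; lra.
  by move=> ?; apply: le_trans (bern m); lra.
have m0' : 0 < m%:R :> R by rewrite ltr0n.
set d : R := (32 * 576 ^+ 2 * m%:R ^+ 4)^-1.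
have d01 : 0 < d <= 1.
  have m1 : 1 <= m%:R ^+ 4 :> R by rewrite exprn_ege1// ler1n.
  have d1 : 1 <= 32 * 576 ^+ 2 * m%:R ^+ 4 :> R by lra.
  have d0 := lt_le_trans ltr01 d1.
  by apply/andP; split; [rewrite invr_gt0|rewrite invf_le1].
have cX : inX X (chi R d).
  apply: (emb _ _).1; split; first exact: measurable_indic.
  exists 1; apply: ae01_all => x _; rewrite /chi indicE.
  by case: (_ \in _); rewrite ?normr0 ?normr1.
have c0 := chi_gt0 _ _ _ d01 cX.
exists (nrmX X (chi R d) / 2), (C * (24 * m%:R)); split.
- by rewrite divr_gt0.
- by rewrite !mulr_gt0.
move=> n lac a K S s; have [SX SC] := emb S (Linf_wsum a n K).
have T0 : 0 <= \sum_(k < K) a k ^+ 2 by apply: sumr_ge0 => k _; exact: sqr_ge0.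
have s0 : 0 <= s by exact: sqrtr_ge0.
have up (r : R) : 0 < r -> s <= r -> nrmX X S <= C * (24 * m%:R) * r.
  move=> r0 sr; apply: (le_trans SC); rewrite -mulrA ler_pM2l//.
  apply: (orlicz_wsum_le q) => //.
  by rewrite -(sqr_sqrtr T0) ler_pXn2r ?nnegrE// ltW.
move: s0; rewrite le_eqVlt => /predU1P[s0|s0].
  have S0 : nrmX X S <= 0.
    rewrite leNgt; apply/negP => S0.
    have B0 : 0 < C * (24 * m%:R) by rewrite !mulr_gt0.
    have e0 : 0 < nrmX X S / (2 * (C * (24 * m%:R))) by rewrite divr_gt0// mulr_gt0.
    have := up _ e0; rewrite -s0 => /(_ (ltW e0)).
    have -> : C * (24 * m%:R) * (nrmX X S / (2 * (C * (24 * m%:R)))) = nrmX X S / 2.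
      by field; rewrite !lt0r_neq0.
    by lra.
  by split=> //; rewrite -s0 !mulr0//; exact: nrm_ge0.
split=> //; last exact: up.
have T1 : 0 < \sum_(k < K) a k ^+ 2 by rewrite -sqrtr_gt0.
have [_] := nrm_ge_chi _ _ _ (s / 2) d SX (ltac:(by rewrite divr_gt0)) d01
  (lacunary_tail_ge _ _ _ a K q1 lac m0 qm T1).
by rewrite mulrC mulrA mulrAC.
Qed.

End LacunarySums.

(** * Infinite sums *)

Section Limit.
Variable R : realType.
Local Notation mu := (@lebesgue_measure R).
Local Notation I01 := (`[(0:R), 1]%classic).
Local Open Scope classical_set_scope.
Implicit Types (a : nat -> R) (n : nat -> nat).

Definition sqsum a K : R := \sum_(k < K) a k ^+ 2.

Lemma sqsum_cvg a : in_l2 a -> sqsum a K @[K --> \oo] --> l2norm a ^+ 2.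
Proof.
move=> al; set u := fun k => ((a k) ^+ 2)%:E.
have u0 k : (0 <= u k)%E by rewrite lee_fin sqr_ge0.
have s0 : (0 <= \sum_(k <oo) u k)%E by apply: nneseries_ge0 => k _ _; exact: u0.
have -> : l2norm a ^+ 2 = fine (\sum_(k <oo) u k)%E by rewrite sqr_sqrtr// fine_ge0.
have : (fun K => (sqsum a K)%:E) @ \oo --> (fine (\sum_(k <oo) u k)%E)%:E.
  rewrite fineK ?ge0_fin_numE//.
  rewrite (_ : (fun K => _) = fun K => (\sum_(0 <= k < K) u k)%E); last first.
    by apply/funext => K; rewrite big_mkord sumEFin.
  by apply: is_cvg_nneseries => k _ _; exact: u0.
by move/fine_cvgP => [_].
Qed.

Lemma sqsum_le a K : in_l2 a -> sqsum a K <= l2norm a ^+ 2.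
Proof.
move=> al; apply: (ler_cvg_to (cvg_cst (sqsum a K)) (sqsum_cvg _ al)).
near=> L; have KL : (K <= L)%N by near: L; exact: nbhs_infty_ge.
rewrite /sqsum -(subnKC KL) big_split_ord /= lerDl.
by apply: sumr_ge0 => k _; exact: sqr_ge0.
Unshelve. all: by end_near. Qed.

Lemma l2norm_ge0 a : 0 <= l2norm a. Proof. exact: sqrtr_ge0. Qed.

Definition cut a M k : R := if (M <= k)%N then a k else 0.

Lemma wsum_cut a n M K x : (M <= K)%N ->
  wsum R (cut a M) n K x = wsum R a n K x - wsum R a n M x.
Proof.
move=> /subnKC <-; rewrite /wsum !big_split_ord /= big1 ?add0r; last first.
  by move=> k _; rewrite /cut leqNgt ltn_ord mul0r.
by rewrite addrAC subrr add0r; apply: eq_bigr => k _; rewrite /cut leq_addr.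
Qed.

Lemma sqsum_cut a M K : (M <= K)%N -> sqsum (cut a M) K = sqsum a K - sqsum a M.
Proof.
move=> /subnKC <-; rewrite /sqsum !big_split_ord /= big1 ?add0r; last first.
  by move=> k _; rewrite /cut leqNgt ltn_ord expr0n.
by rewrite addrAC subrr add0r; apply: eq_bigr => k _; rewrite /cut leq_addr.
Qed.

Lemma integral_sqr_wsumB a n M K : injective n -> (M <= K)%N ->
  (\int[mu]_(x in I01) (2 * (wsum R a n K x - wsum R a n M x) ^+ 2)%:E)%E =
  (2 * (sqsum a K - sqsum a M))%:E.
Proof.
move=> ninj MK; have [N nN] := ex_exp2_bound n K.
rewrite -(sqsum_cut _ _ _ MK) /sqsum -(avg_wsum_sqr _ _ _ _ _ ninj nN) -avgZ.
rewrite -integral_dyadic.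
- by apply: eq_integral => x _; rewrite wsum_cut.
- by apply: (dyadic_comp _ _ (fun y => 2 * y ^+ 2)); exact: dyadic_wsum.
- apply: measurable_funM; first exact: measurable_cst.
  by apply: measurable_funX; exact: measurable_wsum.
- by move=> x; rewrite mulr_ge0 ?sqr_ge0.
Qed.

Variable X : RIspace R.

Lemma nrm_subC f g : inX X (f \- g) -> nrmX X (f \- g) = nrmX X (g \- f).
Proof.
move=> fgX; have := nrmZ (-1) fgX; rewrite normrN1 mul1r => <-; congr nrmX.
by apply/funext => x /=; rewrite mulN1r opprB.
Qed.

Lemma inXB f g : inX X f -> inX X g -> inX X (f \- g).
Proof.
move=> fX gX; have := memD fX (memZ (-1) gX); congr inX.
by apply/funext => x /=; rewrite mulN1r.
Qed.

Lemma cvg_nrm_measure (u : nat -> R -> R) (f : R -> R) (e d : R) : inX X f ->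
  (forall k, inX X (u k)) ->
  nrmX X (u k \- f) @[k --> \oo] --> 0 -> 0 < e -> 0 < d <= 1 ->
  \forall k \near \oo, (mu [set x | I01 x /\ (e <= `|u k x - f x|)%R] < d%:E)%E.
Proof.
move=> fX uX /cvgr0Pnorm_lt uf e0 d01.
have [cX|ncX] := pselect (inX X (chi R d)); last first.
  apply: nearW => k; rewrite ltNge; apply/negP => h; apply: ncX.
  exact: (nrm_ge_chi _ _ (u k \- f) e d (inXB _ _ (uX k) fX) e0 d01 h).1.
have c0 := chi_gt0 _ _ _ d01 cX.
near=> k; rewrite ltNge; apply/negP => h.
have [_] := nrm_ge_chi _ _ (u k \- f) e d (inXB _ _ (uX k) fX) e0 d01 h.
rewrite leNgt => /negP; apply; apply: le_lt_trans (ler_norm _) _.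
by near: k; apply: uf; rewrite mulr_gt0.
Unshelve. all: by end_near. Qed.

Lemma integral_sqr_limit_le a n (f : R -> R) N : injective n -> in_l2 a -> inX X f ->
  (forall K, inX X (wsum R a n K)) ->
  nrmX X (wsum R a n K \- f) @[K --> \oo] --> 0 ->
  (\int[mu]_(x in I01) (`|wsum R a n N x - f x| ^+ 2)%:E <=
    (2 * (l2norm a ^+ 2 - sqsum a N))%:E)%E.
Proof.
move=> ninj al fX SX Sf.
set g := fun x => `|wsum R a n N x - f x| ^+ 2; set tau := 2 * _.
have mf := mem_meas fX; have mS K := measurable_funTS (D := I01) (measurable_wsum R a n K).
have mg : measurable_fun I01 g.
  apply: measurable_funX; apply: (measurableT_comp (@normr_measurable R setT)).
  exact: measurable_funB.
have mB M : measurable_fun I01 (fun x => wsum R a n M x - wsum R a n N x).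
  exact: (measurable_funB (mS M) (mS N)).
have g0 x : 0 <= g x by exact: sqr_ge0.
pose gK (K : nat) x := Num.min (g x) K%:R.
have mgK K : measurable_fun I01 (gK K).
  by apply: measurable_minr => //; exact: measurable_cst.
have gK0 K x : 0 <= gK K x by rewrite le_min g0 ler0n.
have bound K : (\int[mu]_(x in I01) (gK K x)%:E <= tau%:E)%E.
  apply/lee_addgt0Pr => eta eta0.
  pose e := Num.sqrt (eta / 4); have e0 : 0 < e by rewrite sqrtr_gt0 divr_gt0.
  pose d : R := Num.min 1 (eta / (2 * K.+1%:R)).
  have d01 : 0 < d <= 1.
    by rewrite lt_min ltr01 ge_min lexx !andbT divr_gt0// mulr_gt0.
  have : \forall M \near \oo, (N <= M)%N /\
      (mu [set x | I01 x /\ (e <= `|wsum R a n M x - f x|)%R] < d%:E)%E.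
    near=> M; split; first by near: M; exact: nbhs_infty_ge.
    by near: M; exact: cvg_nrm_measure.
  move=> [M _ /(_ M (leqnn M)) [NM muA]].
  set A := [set x | I01 x /\ _] in muA.
  have mA : measurable A.
    rewrite (_ : A = I01 `&` ((fun x => `|wsum R a n M x - f x|) @^-1` `[e, +oo[%classic)).
      apply: (measurableT_comp (@normr_measurable R setT) (measurable_funB (mS M) mf)) => //.
    by apply/seteqP; split=> x /=; rewrite !in_itv /= andbT.
  have pw x : I01 x -> gK K x <= 2 * (wsum R a n M x - wsum R a n N x) ^+ 2 +
      (2 * e ^+ 2 + K%:R * \1_A x).
    move=> xi; rewrite indicE; case: (boolP (x \in A)) => [_|xA].
      rewrite mulr1 /gK ge_min; apply/orP; right; rewrite addrA lerDr.
      by rewrite addr_ge0// mulr_ge0 ?sqr_ge0.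
    have Mf : `|wsum R a n M x - f x| < e.
      by rewrite ltNge; apply/negP => h; move/negP: xA; apply; rewrite inE.
    rewrite mulr0 addr0 /gK ge_min; apply/orP; left; rewrite /g real_normK ?num_real//.
    have : (wsum R a n M x - f x) ^+ 2 <= e ^+ 2.
      by rewrite -[X in X <= _]real_normK ?num_real// ler_pXn2r ?nnegrE// ltW.
    set s := wsum R a n N x; set t := wsum R a n M x.
    have : 0 <= ((t - s) + (t - f x)) ^+ 2 by exact: sqr_ge0.
    by nra.
  apply: (@le_trans _ _ (\int[mu]_(x in I01) ((2 * (wsum R a n M x - wsum R a n N x) ^+ 2)%:E +
      ((2 * e ^+ 2)%:E + (K%:R * \1_A x)%:E)))%E).
    apply: ge0_le_integral => //=.
    - by move=> x _; rewrite lee_fin.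
    - by apply/measurable_EFinP; exact: mgK.
    - apply/measurable_EFinP; apply: measurable_funD.
        apply: measurable_funM; first exact: measurable_cst.
        by apply: measurable_funX; exact: mB.
      apply: measurable_funD; first exact: measurable_cst.
      by apply: measurable_funM; [exact: measurable_cst|exact: measurable_indic].
  have m1 : measurable_fun I01 (fun x => (2 * (wsum R a n M x - wsum R a n N x) ^+ 2)%:E).
    apply/measurable_EFinP; apply: measurable_funM; first exact: measurable_cst.
    by apply: measurable_funX; exact: mB.
  have m3 : measurable_fun I01 (fun x => (K%:R * \1_A x)%:E : \bar R).
    apply/measurable_EFinP.
    by apply: measurable_funM; [exact: measurable_cst|exact: measurable_indic].
  rewrite ge0_integralD//=; last 3 first.
  - by move=> x _; rewrite lee_fin mulr_ge0 ?sqr_ge0.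
  - by move=> x _; apply: adde_ge0; rewrite lee_fin mulr_ge0 ?sqr_ge0// indicE ler0n.
  - by apply: emeasurable_funD => //; exact: measurable_cst.
  rewrite integral_sqr_wsumB// ge0_integralD//=; last first.
    by move=> x _; rewrite lee_fin mulr_ge0 ?sqr_ge0.
  rewrite integral_cst//= lebesgue_measure_itv /= lte_fin ltr01 sube0 mule1.
  under [X in (_ + (_ + X))%E]eq_integral do rewrite EFinM.
  rewrite ge0_integralZl_EFin//=; last by apply/measurable_EFinP; exact: measurable_indic.
  rewrite integral_indic// (_ : A `&` I01 = A); last first.
    by apply/seteqP; split=> x; [case|case=> ? ?; split].
  have muAd := ltW muA; have muAfin : mu A \is a fin_num.
    by rewrite ge0_fin_numE ?measure_ge0//; apply: le_lt_trans muAd (ltry _).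
  move: muAd; rewrite -(fineK muAfin) lee_fin => muAd.
  rewrite [X in (_ * X)%E](_ : _ = (fine (mu A))%:E); last exact/esym/fineK.
  rewrite -EFinM -!EFinD lee_fin; apply: lerD.
    by rewrite ler_pM2l// lerB// sqsum_le.
  have -> : 2 * e ^+ 2 = eta / 2 by rewrite sqr_sqrtr; [lra|rewrite divr_ge0// ltW].
  rewrite [leRHS]splitr lerD2l; apply: (@le_trans _ _ (K.+1%:R * d)).
    by apply: ler_pM => //; [exact: fine_ge0|rewrite ler_nat].
  apply: (@le_trans _ _ (K.+1%:R * (eta / (2 * K.+1%:R)))).
    by rewrite ler_pM2l// ge_min lexx orbT.
  by rewrite le_eqVlt; apply/orP; left; apply/eqP; field; rewrite lt0r_neq0.
have nd x : I01 x -> {homo (fun K => (gK K x)%:E) : K L / (K <= L)%N >-> (K <= L)%E}.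
  by move=> _ K L KL; rewrite lee_fin le_min2// ler_nat.
have := @cvg_monotone_convergence _ _ _ mu I01 (measurable_itv _) (fun K x => (gK K x)%:E)
  (fun K => (measurable_EFinP _ _).2 (mgK K)) (fun K x _ => (ltac:(by rewrite lee_fin) : (0 <= (gK K x)%:E)%E)) nd.
under eq_integral => x _.
  rewrite (_ : limn _ = (g x)%:E).
    over.
  apply/cvg_lim => //; apply: cvg_near_cst; near=> K; congr (_%:E).
  apply/min_idPl; apply: ltW; near: K; exact: nbhs_infty_gtr.
move=> cv; rewrite -(cvg_lim (@ereal_hausdorff _) cv).
apply: lime_le; first by apply/cvg_ex; eexists; exact: cv.
by apply: nearW => K; exact: bound.
Unshelve. all: by end_near. Qed.

Lemma walsh_equiv_finite n (A B : R) : injective n -> 0 < A -> 0 < B ->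
  (forall a K, [/\ inX X (wsum R a n K),
     A * Num.sqrt (sqsum a K) <= nrmX X (wsum R a n K) &
     nrmX X (wsum R a n K) <= B * Num.sqrt (sqsum a K)]) ->
  walsh_equiv X n A B.
Proof.
move=> ninj A0 B0 fin a al; have SX K : inX X (wsum R a n K) by have [] := fin a K.
have diff M K : (M <= K)%N ->
    nrmX X (wsum R a n K \- wsum R a n M) <= B * Num.sqrt (l2norm a ^+ 2 - sqsum a M).
  move=> MK; have [_ _] := fin (cut a M) K.
  rewrite (_ : wsum R (cut a M) n K = wsum R a n K \- wsum R a n M); last first.
    by apply/funext => x; rewrite wsum_cut.
  move/le_trans; apply; rewrite ler_pM2l// ler_wsqrtr// sqsum_cut// lerB//.
  exact: sqsum_le.
have tail : (l2norm a ^+ 2 - sqsum a K) @[K --> \oo] --> (0 : R).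
  by rewrite -(subrr (l2norm a ^+ 2)); apply: cvgB; [exact: cvg_cst|exact: sqsum_cvg].
have Btail : (B * Num.sqrt (l2norm a ^+ 2 - sqsum a K)) @[K --> \oo] --> (0 : R).
  rewrite -(mulr0 B) -[X in B * X](sqrtr0 R); apply: cvgM; first exact: cvg_cst.
  by apply: (cvg_comp _ _ tail); exact: sqrt_continuous.
have cauchy (e : R) : 0 < e -> exists N : nat, forall m n0 : nat, (N <= m)%N -> (N <= n0)%N ->
    nrmX X (wsum R a n m \- wsum R a n n0) < e.
  move=> e0; move/cvgr0Pnorm_lt : Btail => /(_ e e0) [N _ HN]; exists N => i j Ni Nj.
  have small M : (N <= M)%N -> B * Num.sqrt (l2norm a ^+ 2 - sqsum a M) < e.
    by move=> NM; apply: le_lt_trans (ler_norm _) (HN M NM).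
  case/orP: (leq_total i j) => ij.
    by rewrite nrm_subC; [apply: le_lt_trans (diff _ _ ij) (small _ Ni)|exact: inXB].
  exact: le_lt_trans (diff _ _ ij) (small _ Nj).
have [f [fX Sf]] := complete SX cauchy.
have sq : Num.sqrt (sqsum a K) @[K --> \oo] --> l2norm a.
  rewrite -(_ : Num.sqrt (l2norm a ^+ 2) = l2norm a); last by rewrite sqrtr_sqr ger0_norm// l2norm_ge0.
  by apply: (cvg_comp _ _ (sqsum_cvg _ al)); exact: sqrt_continuous.
exists f; split; [|split; [exact: fX|split]].
- split; first exact: mem_meas fX.
  apply: (@squeeze_cvge _ _ _ _ (cst 0%E) _ (fun K => (2 * (l2norm a ^+ 2 - sqsum a K))%:E)).
  + apply: nearW => K; rewrite integral_ge0 /=; last by move=> x _; rewrite lee_fin sqr_ge0.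
    exact: integral_sqr_limit_le.
  + exact: cvg_cst.
  + apply: cvg_EFin; first exact: nearW.
    by rewrite -(mulr0 2); apply: cvgM; [exact: cvg_cst|exact: tail].
- apply: (ler_cvg_to (f := fun K => A * Num.sqrt (sqsum a K))
    (g := fun K => nrmX X (wsum R a n K \- f) + nrmX X f) (a := \oo)).
  + by apply: cvgM; [exact: cvg_cst|exact: sq].
  + by rewrite -[X in _ --> X]add0r; apply: cvgD; [exact: Sf|exact: cvg_cst].
  + apply: nearW => K; have [_ + _] := fin a K => /le_trans; apply.
    have := nrmD (inXB _ _ (SX K) fX) fX; congr (nrmX X _ <= _).
    by apply/funext => x /=; rewrite subrK.
- apply: (ler_cvg_to (f := fun=> nrmX X f)
    (g := fun K => nrmX X (wsum R a n K \- f) + B * Num.sqrt (sqsum a K)) (a := \oo)).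
  + exact: cvg_cst.
  + rewrite -[X in _ --> X]add0r; apply: cvgD; first exact: Sf.
    by apply: cvgM; [exact: cvg_cst|exact: sq].
  + apply: nearW => K; have [_ _ up] := fin a K.
    apply: (@le_trans _ _ (nrmX X (f \- wsum R a n K) + nrmX X (wsum R a n K))).
      have := nrmD (inXB _ _ fX (SX K)) (SX K); congr (nrmX X _ <= _).
      by apply/funext => x /=; rewrite subrK.
    by rewrite -nrm_subC ?lerD2l//; exact: inXB.
Qed.

End Limit.

(** * Lower tails of sums of independent Walsh functions *)

Section FromSubsequence.
Variable R : realType.
Local Notation mu := (@lebesgue_measure R).
Local Notation I01 := (`[(0:R), 1]%classic).
Local Open Scope classical_set_scope.
Implicit Types (a : nat -> R) (n : nat -> nat).

(* Paley-Zygmund applied to the exponential tilt [expR (l * S)]. *)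
Lemma independent_sum_tail_ge n (L : nat) (l : R) : (forall k, (0 < n k)%N) ->
  (forall j k, (j < k)%N -> (trunc_log 2 (n j) < trunc_log 2 (n k))%N) ->
  6 <= l -> l ^+ 2 <= L%:R ->
  ((expR (- (12 * l ^+ 2)) / 4)%:E <=
    mu [set x | I01 x /\ (l / 32 <= wsum R (fun=> (Num.sqrt L%:R)^-1) n L x)%R])%E.
Proof.
move=> n0 nlt l6 lL; set c : R := (Num.sqrt L%:R)^-1; set S := wsum R (fun=> c) n L.
have [N nN] := ex_exp2_bound n L.
have L0 : 0 < L%:R :> R by apply: lt_le_trans lL; apply: exprn_gt0; lra.
have c2 : c ^+ 2 = L%:R^-1 by rewrite exprVn sqr_sqrtr// ltW.
have nN' k : (k < L)%N -> predT k -> (0 < n k < 2 ^ N)%N by move=> kL _; rewrite n0 nN.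
have nlt' j k : (j < k < L)%N -> predT j -> predT k -> (trunc_log 2 (n j) < trunc_log 2 (n k))%N.
  by move=> /andP[jk _] _ _; exact: nlt.
have up : avg R N (fun x => expR (l * S x) ^+ 2) <= expR (12 * l ^+ 2).
  have := avg_expR_indep_le R N predT n (fun=> c) L (2 * l) nN' nlt'.
  rewrite sumr_const card_ord c2 -[_ *+ L]mulr_natr mulVf ?gt_eqF// mulr1.
  rewrite (_ : 3 * _ = 12 * l ^+ 2); last by ring.
  congr (avg _ _ _ <= _); apply/funext => x.
  by rewrite -expRM_natl mulrA.
have lo : expR (l ^+ 2 / 16) <= avg R N (fun x => expR (l * S x)).
  have := avg_expR_indep R N predT n (fun=> c) L l nN' nlt'; rewrite /S /wsum => ->.
  rewrite prodr_const card_ord.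
  have h : expR ((l * c) ^+ 2 / 16) <= (expR (l * c) + expR (- (l * c))) / 2.
    rewrite ler_pdivlMr// mulrC; apply: coshR_ge; rewrite exprMn c2 ler_pdivrMr//.
    by apply: (le_trans lL); lra.
  apply: le_trans (_ : expR ((l * c) ^+ 2 / 16) ^+ L <= _); last first.
    apply: lerXn2r h; rewrite nnegrE; first exact: expR_ge0.
    by rewrite divr_ge0// addr_ge0 ?expR_ge0.
  rewrite -expRM_natl exprMn c2 ler_expR.
  by rewrite le_eqVlt; apply/orP; left; apply/eqP; field; rewrite lt0r_neq0.
have := paley_zygmund _ N (fun x => expR (l * S x)) _ _ (expR_gt0 _) (expR_gt0 _) (fun x => expR_ge0 _) lo up.
have mS := measurable_wsum R (fun=> c) n L.
pose P (y : R) := expR (l ^+ 2 / 16) / 2 <= expR (l * y).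
have mP : measurable [set y : R | P y].
  have m1 : measurable_fun setT (fun y : R => expR (l * y)).
    by apply: (measurableT_comp (@measurable_expR R)); apply: measurable_funM => //; exact: measurable_cst.
  have := m1 measurableT `[expR (l ^+ 2 / 16) / 2, +oo[%classic (measurable_itv _).
  by rewrite setTI; congr measurable; apply/seteqP; split=> x /=; rewrite in_itv /= andbT.
rewrite -lee_fin -(measure_dyadic _ _ S P)//; last exact: dyadic_wsum.
move=> h; apply: le_trans (_ : _ <= _)%E.
  apply: le_trans h.
  rewrite lee_fin (_ : _ / (4 * _) = expR (l ^+ 2 / 8 - 12 * l ^+ 2) / 4); last first.
    rewrite (_ : l ^+ 2 / 8 = 2%:R * (l ^+ 2 / 16)); last by field.
    by rewrite expRD expRN (expRM_natl 2); field; rewrite lt0r_neq0 ?expR_gt0.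
  rewrite ler_pM2r// ler_expR.
  have : 0 <= l ^+ 2 by exact: sqr_ge0.
  by lra.
apply: le_measure; rewrite ?inE.
- rewrite (_ : [set x | _] = I01 `&` (S @^-1` [set y : R | P y])).
    apply: measurableI; first exact: measurable_itv.
    by rewrite -[X in measurable X]setTI; exact: mS.
  by apply/seteqP; split=> x.
- rewrite (_ : [set x | _] = I01 `&` (S @^-1` `[l / 32, +oo[%classic)).
    apply: measurableI; first exact: measurable_itv.
    by rewrite -[X in measurable X]setTI; exact: mS.
  by apply/seteqP; split=> x /=; rewrite !in_itv /= andbT.
- move=> x /= [xi Px]; split=> //; move: Px; rewrite /P ler_pdivrMr//.
  have e2 : (2 : R) <= expR (l ^+ 2 / 32) by have := expR_ge1Dx (l ^+ 2 / 32); nra.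
  have -> : expR (l ^+ 2 / 16) = expR (l ^+ 2 / 32) * expR (l ^+ 2 / 32).
    by rewrite -expRD; congr expR; field.
  move=> h2; have g0 := expR_gt0 (l ^+ 2 / 32); have g1 := expR_gt0 (l * S x).
  have : expR (l ^+ 2 / 32) <= expR (l * S x) by nra.
  by rewrite ler_expR expr2 -mulrA ler_pM2l//; lra.
Qed.

Lemma finite_l2 a K : (forall k, (K <= k)%N -> a k = 0) ->
  in_l2 a /\ l2norm a = Num.sqrt (sqsum R a K).
Proof.
move=> a0; have E : (\sum_(k <oo) ((a k) ^+ 2)%:E)%E = (sqsum R a K)%:E.
  apply/cvg_lim => //; apply: cvg_near_cst; near=> L.
  have KL : (K <= L)%N by near: L; exact: nbhs_infty_ge.
  rewrite big_mkord sumEFin -(subnKC KL) big_split_ord /= [X in _ + X]big1 ?addr0// => k _.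
  by rewrite a0 ?expr0n// leq_addr.
by rewrite /in_l2 /l2norm E ltry.
Unshelve. all: by end_near. Qed.

Variable X : RIspace R.

Lemma walsh_equiv_wsum n (A B : R) a K : walsh_equiv X n A B ->
  (forall k, (K <= k)%N -> a k = 0) ->
  [/\ inX X (wsum R a n K), A * Num.sqrt (sqsum R a K) <= nrmX X (wsum R a n K) &
      nrmX X (wsum R a n K) <= B * Num.sqrt (sqsum R a K)].
Proof.
move=> we a0; have [al l2E] := finite_l2 a K a0.
have [F [[mF L2F] [FX [lo up]]]] := we a al.
have mS := measurable_funTS (D := I01) (measurable_wsum R a n K).
pose g x := `|wsum R a n K x - F x| ^+ 2.
have mg : measurable_fun I01 g.
  apply: measurable_funX; apply: (measurableT_comp (@normr_measurable R setT)).
  exact: measurable_funB.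
have I0 : (\int[mu]_(x in I01) `|(g x)%:E| = 0)%E.
  apply: cvg_unique L2F; first exact: ereal_hausdorff.
  apply: cvg_near_cst; near=> N; have KN : (K <= N)%N by near: N; exact: nbhs_infty_ge.
  apply: eq_integral => x _; rewrite (_ : \sum_(k < N) _ = wsum R a n K x).
    by rewrite /= [in RHS]ger0_norm ?sqr_ge0.
  rewrite -(subnKC KN) big_split_ord /= [X in _ + X]big1 ?addr0// => k _.
  by rewrite a0 ?mul0r// leq_addr.
have aeE : ae01 (fun x => F x = wsum R a n K x).
  have := (ae_eq_integral_abs mu (measurable_itv _) ((measurable_EFinP _ _).2 mg)).1 I0.
  apply: filterS => x /[apply] -[] /eqP.
  by rewrite sqrf_eq0 normr_eq0 subr_eq0 => /eqP ->.
have [SX Sle] : inX X (wsum R a n K) /\ nrmX X (wsum R a n K) <= nrmX X F.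
  by apply: ideal => //; apply: negligibleS aeE => x H h; apply: H => /h ->.
have [_ Fle] : inX X F /\ nrmX X F <= nrmX X (wsum R a n K).
  by apply: ideal => //; apply: negligibleS aeE => x H h; apply: H => /h ->.
rewrite -l2E; split=> //; first exact: le_trans Fle.
exact: le_trans up.
Unshelve. all: by end_near. Qed.

Lemma wsum_delta n i K x : (i < K)%N -> wsum R (fun k => (k == i)%:R) n K x = walsh (n i) x.
Proof.
move=> iK; rewrite /wsum (bigD1 (Ordinal iK))//= eqxx mul1r big1 ?addr0// => k ki.
by rewrite -val_eqE /= in ki; rewrite (negPf ki) mul0r.
Qed.

Lemma walsh_equiv_inj n (A B : R) : 0 < A -> walsh_equiv X n A B -> injective n.
Proof.
move=> A0 we i j nij; apply/eqP/negP => ij.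
pose a k : R := (k == i)%:R - (k == j)%:R; pose K := (maxn i j).+1.
have iK : (i < K)%N by rewrite ltnS leq_maxl.
have jK : (j < K)%N by rewrite ltnS leq_maxr.
have a0 k : (K <= k)%N -> a k = 0.
  by move=> Kk; rewrite /a !gtn_eqF ?subrr// (leq_trans _ Kk).
have S0 : wsum R a n K = fun=> 0.
  apply/funext => x; rewrite /wsum; under eq_bigr do rewrite mulrBl.
  rewrite sumrB; have := wsum_delta n i K x iK; have := wsum_delta n j K x jK.
  by rewrite /wsum => -> ->; rewrite nij subrr.
have [SX lo _] := walsh_equiv_wsum n A B a K we a0.
have := (nrm_eq0 SX).2; rewrite S0 => /(_ (ae01_all _ _ (fun _ _ => erefl))).
rewrite -S0 => n0; move: lo; rewrite n0 leNgt => /negP; apply.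
rewrite mulr_gt0// sqrtr_gt0 /sqsum (bigD1 (Ordinal iK))//= ltr_wpDr//.
  by apply: sumr_ge0 => k _; exact: sqr_ge0.
by rewrite /a eqxx; case: eqP => [/eqP//|_]; rewrite subr0 expr1n.
Qed.

Lemma increasing_log_subsequence n : injective n -> exists kap : nat -> nat,
  (forall i, (0 < n (kap i))%N) /\
  (forall i j, (i < j)%N -> (trunc_log 2 (n (kap i)) < trunc_log 2 (n (kap j)))%N).
Proof.
move=> ninj; have unb b : exists k, (b <= n k)%N.
  apply: contrapT => H; have lt k : (n k < b)%N.
    by rewrite ltnNge; apply/negP => h; apply: H; exists k.
  pose g (i : 'I_b.+1) : 'I_b := Ordinal (lt i).
  have : injective g by move=> i j [] /ninj/ord_inj.
  by move/leq_card; rewrite !card_ord ltnn.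
have [g gP] := choice unb.
pose kap := fix kap i := if i is j.+1 then g (2 ^ (trunc_log 2 (n (kap j))).+1)%N else g 1%N.
have k0 i : (0 < n (kap i))%N.
  by case: i => [|i]; [exact: (gP 1%N)|apply: leq_trans (gP _); rewrite expn_gt0].
exists kap; split=> //.
apply: (@homo_ltn _ (fun i => trunc_log 2 (n (kap i))) (fun b c => (b < c)%N)) => [y x z|i]; first exact: ltn_trans.
by apply: trunc_log_max => //; exact: (gP _).
Qed.

Lemma inX_subsum n (A B : R) kap (L : nat) : 0 < A -> walsh_equiv X n A B ->
  injective (n \o kap) -> (0 < L)%N ->
  let S := wsum R (fun=> (Num.sqrt L%:R)^-1) (n \o kap) L in
  inX X S /\ nrmX X S <= B.
Proof.
move=> A0 we kinj L0; set c : R := (Num.sqrt L%:R)^-1; have ninj := walsh_equiv_inj n A B A0 we.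
pose a k : R := \sum_(i < L) (c * (k == kap i)%:R).
pose K := (\max_(i < L) kap i).+1.
have kK i : (i < L)%N -> (kap i < K)%N by move=> iL; rewrite ltnS (leq_bigmax (Ordinal iL)).
have a0 k : (K <= k)%N -> a k = 0.
  move=> Kk; rewrite /a big1// => i _; rewrite gtn_eqF ?mulr0//.
  by apply: leq_trans Kk; exact: kK.
have SE : wsum R a n K = wsum R (fun=> c) (n \o kap) L.
  apply/funext => x; rewrite /wsum; under eq_bigr do rewrite /a mulr_suml.
  rewrite exchange_big /=; apply: eq_bigr => i _.
  have := wsum_delta n (kap i) K x (kK i (ltn_ord i)); rewrite /wsum => <-.
  by rewrite mulr_sumr; apply: eq_bigr => k _; rewrite mulrA.
have [N1 nN1] := ex_exp2_bound n K; have [N2 nN2] := ex_exp2_bound (n \o kap) L.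
have sq1 : sqsum R a K = 1.
  have nN k : (k < K)%N -> (n k < 2 ^ (N1 + N2))%N.
    by move=> /nN1 h; apply: leq_trans h _; rewrite leq_exp2l// leq_addr.
  have nN' k : (k < L)%N -> ((n \o kap) k < 2 ^ (N1 + N2))%N.
    by move=> /nN2 h; apply: leq_trans h _; rewrite leq_exp2l// leq_addl.
  rewrite /sqsum -(avg_wsum_sqr _ _ _ _ _ ninj nN) SE (avg_wsum_sqr _ _ _ _ _ kinj nN').
  rewrite sumr_const card_ord -[_ *+ L]mulr_natr exprVn sqr_sqrtr ?ler0n//.
  by rewrite mulVf// pnatr_eq0 -lt0n.
have := walsh_equiv_wsum n A B a K we a0; rewrite sq1 sqrtr1 mulr1 SE => -[].
by rewrite mulr1.
Qed.

Lemma inX_cst1 n (A B : R) : walsh_equiv X n A B -> inX X (fun=> 1).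
Proof.
move=> we; have [|WX _ _] := walsh_equiv_wsum n A B (fun k => (k == 0)%:R) 1 we.
  by case.
have WE : wsum R (fun k => (k == 0)%:R) n 1 = walsh (n 0%N).
  by apply/funext => x; exact: wsum_delta.
rewrite WE in WX.
have L1 : Linf (fun=> 1 : R).
  by split; [exact: measurable_cst|exists 1; apply: ae01_all => x _; rewrite normr1].
have LW : Linf (walsh (n 0%N) : R -> R).
  split; first exact: measurable_funTS (measurable_walsh _ _).
  by exists 1; apply: ae01_all => x _; exact: walsh_le1.
apply: (nrm_dominated _ _ _ _ L1 LW WX _).1 => t t0.
have [t1|t1] := ltP t 1; last first.
  rewrite (_ : dist _ _ t = 0) ?measure_ge0// /dist -[RHS](measure0 mu); congr (mu _).
  by apply/seteqP; split=> x //= [_]; rewrite normr1 ltNge t1.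
apply: le_trans (dist_le1 _ _ _ L1.1) _.
have nn : (n 0%N < 2 ^ n 0%N)%N by exact: ltn_expl.
rewrite /dist (measure_dyadic _ _ (walsh (n 0%N)) (fun y => t < `|y|) (dyadic_walsh _ _ _ nn)).
- rewrite lee_fin (eq_avg _ _ _ (fun=> 1)) ?avg_cst// => j.
  have /eqP := sqr_walsh R _ _ j nn; rewrite sqrf_eq1 => /orP[] /eqP ->.
    by rewrite normr1 t1.
  by rewrite normrN1 t1.
- exact: measurable_walsh.
- have := @normr_measurable R setT measurableT `]t, +oo[%classic (measurable_itv _).
  by rewrite setTI; congr measurable; apply/seteqP; split=> x /=; rewrite in_itv /= andbT.
Qed.

Lemma orlicz_dist_le (f : R -> R) (t : R) : measurable_fun I01 f -> 1 <= t ->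
  (\int[mu]_(x in I01) (M2 `|f x|)%:E <= 1)%E ->
  (dist R f t <= (2 * expR (- t ^+ 2))%:E)%E.
Proof.
move=> mf t1 I1; have mA := measurable_level _ f t mf.
set A := [set x | _] in mA.
have e2 : 2 <= expR (t ^+ 2).
  by have := expR_ge1Dx (t ^+ 2); have := exprn_ege1 2 t1; lra.
have M0 : 0 < M2 t by rewrite /M2 subr_gt0; lra.
have h : ((M2 t)%:E * mu A <= 1)%E.
  apply: le_trans I1; have -> : A = A `&` I01 by apply/seteqP; split=> x; [case|case].
  rewrite -integral_indic// -ge0_integralZl_EFin//=; last 2 first.
  - by apply/measurable_EFinP; exact: measurable_indic.
  - exact: ltW.
  apply: ge0_le_integral => //=.
  - by move=> x _; rewrite lee_fin indicE mulr_ge0 ?ler0n// ltW.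
  - by apply/measurable_EFinP; apply: measurable_funM; [exact: measurable_cst|exact: measurable_indic].
  - apply/measurable_EFinP; apply: measurable_funB; last exact: measurable_cst.
    apply: (measurableT_comp (@measurable_expR R)); apply: measurable_funX.
    exact: (measurableT_comp (@normr_measurable R setT)).
  move=> x _; rewrite lee_fin indicE; case: (boolP (x \in A)) => [|_]; last by rewrite mulr0 M2_ge0.
  rewrite inE => -[_ tf]; rewrite mulr1 lerB// ler_expR; apply: lerXn2r (ltW tf).
    by rewrite nnegrE (le_trans ler01 t1).
  by rewrite nnegrE normr_ge0.
have fA : mu A \is a fin_num.
  by rewrite ge0_fin_numE ?measure_ge0//; apply: le_lt_trans (dist_le1 _ f t mf) (ltry _).
rewrite /dist -/A -(fineK fA) lee_fin; move: h; rewrite -(fineK fA) -EFinM lee_fin.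
rewrite expRN /M2 => h; have p0 : 0 <= fine (mu A) by exact: fine_ge0.
by rewrite ler_pdivlMr ?expR_gt0//; nra.
Qed.

End FromSubsequence.

(** * The embedding *)

Section Embedding.
Variables (R : realType) (X : RIspace R).
Local Notation mu := (@lebesgue_measure R).
Local Notation I01 := (`[(0:R), 1]%classic).
Local Open Scope classical_set_scope.

Lemma dist_ae_bound (g : R -> R) (M t : R) : measurable_fun I01 g ->
  ae01 (fun x => `|g x| <= M) -> M <= t -> dist R g t = 0.
Proof.
move=> mg gM Mt; apply: measure_negligible; first exact: measurable_level.
apply: negligibleS gM => y /= [yi ty] H; have := H yi.
by rewrite leNgt (le_lt_trans Mt ty).
Qed.

(* The distribution of a function in the unit ball of [L^{M_2}] is at most
   [2 exp(-t^2)], hence is dominated by that of [160 (1 + |S|)] with [S] a normalized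
   sum of sufficiently many independent signs. *)
Lemma unit_ball_bound n (A B : R) (g : R -> R) : 0 < A -> walsh_equiv X n A B -> Linf g ->
  (\int[mu]_(x in I01) (M2 `|g x|)%:E <= 1)%E ->
  inX X g /\ nrmX X g <= 160 * (nrmX X (fun=> 1) + B).
Proof.
move=> A0 we gL I1; have [mg [M gM]] := gL.
have [kap [k0 klt]] := increasing_log_subsequence _ (walsh_equiv_inj _ _ _ _ _ A0 we).
have kinj : injective (n \o kap).
  by move=> i j /= e; case: (ltngtP i j) => // /klt; rewrite e ltnn.
have X1 := inX_cst1 _ _ _ _ _ we.
pose M0 := Num.max M 160; pose L := (Num.truncn ((M0 / 5) ^+ 2)).+1.
have LM : (M0 / 5) ^+ 2 <= L%:R.
  by have /andP[_ /ltW] := truncn_itv (sqr_ge0 (M0 / 5)).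
have [SX SB] := inX_subsum _ _ _ _ _ kap L A0 we kinj (ltn0Sn _).
set S := wsum _ _ _ _ in SX SB.
have mS : measurable_fun setT S by exact: measurable_wsum.
have mSn : measurable_fun setT (fun x => `|S x|) by exact: (measurableT_comp (@normr_measurable R setT)).
have [NX NS] : inX X (fun x => `|S x|) /\ nrmX X (fun x => `|S x|) <= nrmX X S.
  apply: ideal => //; first exact: measurable_funTS mSn.
  by apply: ae01_all => x _; rewrite normr_id.
pose h x := 160 * (1 + `|S x|).
have hX : inX X h := memZ 160 (memD X1 NX).
have hle : nrmX X h <= 160 * (nrmX X (fun=> 1) + B).
  rewrite (nrmZ 160 (memD X1 NX)) ger0_norm// ler_pM2l//.
  by apply: le_trans (nrmD X1 NX) _; rewrite lerD2l (le_trans NS).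
have hpos x : 0 <= h x by rewrite mulr_ge0// addr_ge0.
have mh : measurable_fun setT h.
  by apply: measurable_funM; [exact: measurable_cst|apply: measurable_funD => //; exact: measurable_cst].
have hL : Linf h.
  split; first exact: measurable_funTS mh.
  have [_ [K SK]] := Linf_wsum R (fun=> (Num.sqrt L%:R)^-1) (n \o kap) L.
  exists (160 * (1 + K)); apply: negligibleS SK => x H xle; apply: H => xi.
  rewrite ger0_norm ?hpos// ler_pM2l// lerD2l; exact: xle.
suff dd t : 0 <= t -> (dist R g t <= dist R h t)%E.
  have [gX gh] := nrm_dominated _ _ _ _ gL hL hX dd.
  by split=> //; exact: le_trans gh hle.
move=> t0; have [t160|t160] := ltP t 160.
  apply: (le_trans (dist_le1 _ _ _ mg)).
  have -> : 1%E = mu I01 by rewrite lebesgue_measure_itv /= lte_fin ltr01 sube0.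
  apply: le_measure; rewrite ?inE; [exact: measurable_itv|exact: measurable_level hL.1|].
  move=> x xi; split=> //; rewrite ger0_norm ?hpos//; apply: (lt_le_trans t160).
  by rewrite ler_peMr// lerDl.
have [Mt|tM] := leP M0 t.
  by rewrite (dist_ae_bound _ M)// ?measure_ge0//; apply: le_trans Mt; rewrite le_max lexx.
have t1 : 1 <= t by lra.
apply: (le_trans (orlicz_dist_le _ _ _ mg t1 I1)).
have l6 : 6 <= t / 5 by lra.
have lL : (t / 5) ^+ 2 <= L%:R.
  apply: le_trans LM; rewrite ler_pXn2r ?nnegrE ?ler_pM2r ?divr_ge0 ?(ltW tM)//.
  exact: le_trans t0 (ltW tM).
have tail := independent_sum_tail_ge R (n \o kap) L (t / 5) k0 klt l6 lL.
apply: le_trans (_ : _ <= mu [set x | I01 x /\ (t / 5 / 32 <= S x)%R])%E _.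
  apply: le_trans tail; rewrite lee_fin.
  have -> : expR (- t ^+ 2) = expR (- (12 * (t / 5) ^+ 2)) * (expR (t ^+ 2 * (13 / 25)))^-1.
    by rewrite -expRN -expRD; congr expR; field.
  have e8 : 8 <= expR (t ^+ 2 * (13 / 25)).
    by have := expR_ge1Dx (t ^+ 2 * (13 / 25)); nra.
  have : (expR (t ^+ 2 * (13 / 25)))^-1 <= 8^-1.
    by rewrite lef_pV2 ?posrE ?expR_gt0.
  by have := expR_gt0 (- (12 * (t / 5) ^+ 2)); nra.
apply: le_measure; rewrite ?inE.
- rewrite (_ : [set x | _] = I01 `&` (S @^-1` `[t / 5 / 32, +oo[%classic)).
    apply: measurableI; first exact: measurable_itv.
    by rewrite -[X in measurable X]setTI; exact: mS.
  by apply/seteqP; split=> x /=; rewrite !in_itv /= andbT.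
- exact: measurable_level hL.1.
- move=> x /= [xi Sx]; split=> //; rewrite ger0_norm ?hpos// /h.
  by have := ler_norm (S x); lra.
Qed.

Lemma embedding_of_walsh_equiv n (A B : R) : 0 < A -> 0 < B -> walsh_equiv X n A B ->
  exists C : R, 0 < C /\
    forall f, Linf f -> inX X f /\ nrmX X f <= C * orlicz_M2_norm f.
Proof.
move=> A0 B0 we; set C := 160 * (nrmX X (fun=> 1) + B).
have C0 : 0 < C.
  by rewrite mulr_gt0// ltr_wpDl// nrm_ge0//; exact: inX_cst1 we.
exists C; split=> // f fL; have [mf [M fM]] := fL.
have scaled (l : R) : 0 < l -> (\int[mu]_(x in I01) (M2 (`|f x| / l))%:E <= 1)%E ->
    inX X f /\ nrmX X f <= C * l.
  move=> l0 I1; pose g x := l^-1 * f x.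
  have ng x : `|g x| = `|f x| / l by rewrite normrM gtr0_norm ?invr_gt0// mulrC.
  have gL : Linf g.
    split; first by apply: measurable_funM => //; exact: measurable_cst.
    exists (M / l); apply: negligibleS fM => x H h; apply: H => xi; rewrite ng ler_pM2r ?invr_gt0//.
    exact: h.
  have [] := unit_ball_bound n A B g A0 we gL.
    by under eq_integral do rewrite ng.
  move=> gX gC; have fE : f = fun x => l * g x.
    by apply/funext => x; rewrite /g mulrA mulfV ?mul1r// gt_eqF.
  rewrite fE; split; first exact: memZ.
  by rewrite nrmZ// gtr0_norm// mulrC ler_pM2r.
have [l [l0 Il]] : exists l : R, 0 < l /\
    (\int[mu]_(x in I01) (M2 (`|f x| / l))%:E <= 1)%E.
  exists (2 * (`|M| + 1)); have l0 : 0 < 2 * (`|M| + 1) by rewrite mulr_gt0// ltr_wpDl.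
  split=> //; have <- : (\int[mu]_(x in I01) (cst 1 x) = 1)%E.
    by rewrite integral_cst//= lebesgue_measure_itv /= lte_fin ltr01 sube0 mule1.
  apply: ae_ge0_le_integral => //=.
  - by move=> x _; rewrite lee_fin M2_ge0.
  - apply/measurable_EFinP; apply: measurable_funB; last exact: measurable_cst.
    apply: (measurableT_comp (@measurable_expR R)); apply: measurable_funX.
    apply: measurable_funM; last exact: measurable_cst.
    exact: (measurableT_comp (@normr_measurable R setT)).
  apply: negligibleS fM => x H h; apply: H => xi; rewrite lee_fin /M2.
  set y := _ / _; have y2 : y ^+ 2 <= 1 / 4.
    have y0 : 0 <= y by rewrite divr_ge0// ltW.
    have y1 : y <= 1 / 2.
      by rewrite ler_pdivrMr//; apply: le_trans (h xi) _; apply: le_trans (ler_norm M) _; lra.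
    by nra.
  rewrite lerBlDr; apply: le_trans (_ : expR 4^-1 <= _); first by rewrite ler_expR (le_trans y2)// div1r.
  rewrite (_ : 1 + 1 = 2^-1^-1); last by rewrite invrK.
  rewrite -[leLHS]invrK lef_pV2 ?posrE ?invr_gt0 ?expR_gt0//.
  by rewrite -expRN; have := expR_ge1Dx (- 4^-1 : R); lra.
split; first exact: (scaled l l0 Il).1.
rewrite -ler_pdivrMl//; apply: lb_le_inf; first by exists l.
by move=> r [r0 Ir]; rewrite ler_pdivrMl//; exact: (scaled r r0 Ir).2.
Qed.

Lemma walsh_equiv_lacunary (C q : R) : 0 < C -> 1 < q ->
  (forall f, Linf f -> inX X f /\ nrmX X f <= C * orlicz_M2_norm f) ->
  exists A B : R, 0 < A /\ 0 < B /\ forall n, lacunary q n -> walsh_equiv X n A B.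
Proof.
move=> C0 q1 emb; have [A [B [A0 B0 fin]]] := lacunary_finite_sums _ _ _ _ C0 q1 emb.
exists A, B; do 2 split=> //; move=> n lac.
by apply: walsh_equiv_finite => //; [exact: lacunary_inj lac|exact: fin].
Qed.

End Embedding.

Lemma lacunary_exp2 (R : realType) : lacunary (2 : R) (fun k => 2 ^ k)%N.
Proof.
move=> k; rewrite expn_gt0; split=> //.
by rewrite ler_pdivlMr ?ltr0n ?expn_gt0// expnS natrM.
Qed.

Theorem theorem3p5 (R : realType) (X : RIspace R) :
  let i := exists C : R, 0 < C /\
        forall f, Linf f -> inX X f /\ nrmX X f <= C * orlicz_M2_norm f in
  let ii := forall q : R, 1 < q -> exists A B : R, 0 < A /\ 0 < B /\
        forall n : nat -> nat, lacunary q n -> walsh_equiv X n A B in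
  let iii := exists n : nat -> nat, exists A B : R, 0 < A /\ 0 < B /\
        walsh_equiv X n A B in
  (i <-> ii) /\ (ii <-> iii).
Proof.
move=> i ii iii.
have i_ii : i -> ii by move=> [C [C0 emb]] q q1; exact: walsh_equiv_lacunary C0 q1 emb.
have ii_iii : ii -> iii.
  move=> /(_ 2); rewrite ltr1n => /(_ isT) [A [B [A0 [B0 H]]]].
  exists (fun k => 2 ^ k)%N, A, B; do 2 split=> //; apply: H; exact: lacunary_exp2.
have iii_i : iii -> i.
  by move=> [n [A [B [A0 [B0 we]]]]]; exact: embedding_of_walsh_equiv A0 B0 we.
by split; split; auto.
Qed.
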